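(* Let $\Omega \subset \mathbb{C}$ be a bounded open convex set with smooth boundary $\partial \Omega$. Let $T$ be an operator on a finite-dimensional Hilbert space $H$ with $W(T) \subset \Omega$ and let $\mathcal{A} \subset A(\Omega)$ be a finite-dimensional subspace. Then there exist a finite-dimensional Hilbert space $K \supset H$ and a normal operator $N$ on $K$ with $\sigma(N) \subset \partial \Omega$ such that $$ f(T) + (C\overline{f})(T)^* = 2 P_H f(N) \big|_H $$ for all $f \in \mathcal{A}$. We may achieve that $\dim(K) \le 2 \dim(H)^3 (\dim(\mathcal{A}) + 1)$.
   Context: $W(T) = \{ \langle T\xi,\xi\rangle : \xi \in H, \|\xi\|=1\}$ is the numerical range of $T$; one has $\sigma(T) \subset \overline{W(T)}$, and $W(T)$ is compact when $\dim H<\infty$. $A(\Omega)$ is the algebra of all holomorphic functions on $\Omega$ that extend continuously to $\overline{\Omega}$. For $f \in A(\Omega)$, the Cauchy transform of $\overline f$ is the holomorphic function $(C\overline f)(z) = \frac{1}{2\pi i}\int_{\partial\Omega} \frac{\overline{f(\zeta)}}{\zeta - z}\, d\zeta$ for $z \in \Omega$ (with $\partial\Omega$ positively oriented). $f(T)$ and $(C\overline f)(T)$ are defined by the holomorphic functional calculus (as $\sigma(T)\subset\Omega$), and $f(N)$ by the continuous functional calculus applied to the continuous extension of $f$ restricted to $\partial\Omega$. $K \supset H$ means $H$ is a subspace of $K$, and $P_H$ is the orthogonal projection onto $H$. *)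

(* Defs.v *)
From HB Require Import structures.
From mathcomp Require Import all_boot all_order all_algebra sesquilinear spectral.
From mathcomp Require Import all_classical all_reals all_analysis.
From mathcomp Require Import complex.

Set Implicit Arguments.
Unset Strict Implicit.
Unset Printing Implicit Defensive.

Import Order.TTheory GRing.Theory Num.Theory.
Import numFieldNormedType.Exports.

Local Open Scope classical_set_scope.
Local Open Scope ring_scope.
Local Open Scope complex_scope.
Local Open Scope sesquilinear_scope.

(* The topology and the norm of the complex plane are carried by the alias
   [R[i]^o]; it is convertible to [R[i]], which is used for scalars and matrix
   entries. In particular [derivable f z 1] for [f : R[i]^o -> R[i]^o] is
   complex differentiability: the increment ranges over [R[i]].

   Finite-dimensional Hilbert spaces are the spaces 'cV[R[i]]_n with the inner
   product <u, v> = v^* u, and operators are square matrices acting on columns. *)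

Section ComplexPaths.
Variable R : realType.
Implicit Types (gamma : R -> R[i]^o) (g : R[i]^o -> R[i]^o).

Definition re_path gamma : R -> R := fun t => complex.Re (gamma t).
Definition im_path gamma : R -> R := fun t => complex.Im (gamma t).

Definition path_deriv gamma (t : R) : R[i] :=
  derive1 (re_path gamma) t +i* derive1 (im_path gamma) t.

Definition C1_fun (h : R -> R) : Prop :=
  (forall t, derivable h t 1) /\ continuous (derive1 h).

Definition smooth_fun (h : R -> R) : Prop :=
  forall (k : nat) (t : R), derivable (derive1n k h) t 1.

Definition contour_int gamma g : R[i] :=
  let F t : R[i] := g (gamma t) * path_deriv gamma t in
  (\int[lebesgue_measure]_(t in `[0, 1]) complex.Re (F t)) +i*
  (\int[lebesgue_measure]_(t in `[0, 1]) complex.Im (F t)).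

Definition inv_2pii : R[i] := (0 +i* (2 * pi))^-1.

Definition winding gamma (z : R[i]) : R[i] :=
  inv_2pii * contour_int gamma (fun zeta => (zeta - z)^-1).

End ComplexPaths.

Section Domains.
Variable R : realType.
Implicit Types (Omega : set R[i]^o) (gamma : R -> R[i]^o).

Definition bdry Omega : set R[i]^o := closure Omega `\` Omega^°.

(* [gamma] is a positively oriented, regular, C^oo parametrization of the
   boundary, which is thus a smooth Jordan curve. *)
Record smooth_boundary Omega gamma : Prop := SmoothBoundary {
  sb_smooth_re : smooth_fun (re_path gamma);
  sb_smooth_im : smooth_fun (im_path gamma);
  sb_periodic : forall t, gamma (t + 1) = gamma t;
  sb_regular : forall t, path_deriv gamma t != 0;
  sb_inj : {in `[0, 1[ &, injective gamma};
  sb_range : range gamma = bdry Omega;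
  sb_positive : forall z, Omega z -> winding gamma z = 1 }.

(* A(Omega). An element is represented by its continuous extension to the
   closure of Omega, set to 0 off the closure; this makes equality in A(Omega)
   equality of functions, hence A(Omega) a linear space of functions. *)
Definition A_alg Omega : set (R[i]^o -> R[i]^o) :=
  [set f | [/\ forall z, Omega z -> derivable f z 1,
               {within closure Omega, continuous f}
             & forall z, ~ closure Omega z -> f z = 0]].

Definition is_subspace_of_dim (A : set (R[i]^o -> R[i]^o)) (d : nat) : Prop :=
  exists a : 'I_d -> R[i]^o -> R[i]^o,
    (forall c : 'I_d -> R[i],
        (forall z, \sum_(k < d) c k * a k z = 0) -> forall k, c k = 0) /\
    A = [set f | exists c : 'I_d -> R[i],
                   forall z, f z = \sum_(k < d) c k * a k z].

Definition cauchy_conj gamma (f : R[i]^o -> R[i]^o) : R[i]^o -> R[i]^o :=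
  fun z => inv_2pii R *
    contour_int gamma (fun zeta => Num.conj (f zeta) / (zeta - z)).

End Domains.

Section Operators.
Variable R : realType.
Implicit Types (Omega : set R[i]^o) (gamma : R -> R[i]^o).

Definition numerical_range n (T : 'M[R[i]]_n) : set R[i]^o :=
  [set w | exists xi : 'cV[R[i]]_n,
             xi^t* *m xi = 1%:M /\ w = (xi^t* *m (T *m xi)) 0 0].

Definition spectrum n (T : 'M[R[i]]_n) : set R[i]^o :=
  [set z | eigenvalue T z].

(* A C^1 closed curve in Omega \ S, of index 1 around S and 0 around the
   complement of Omega. A single curve, rather than a cycle, is enough because
   the domains considered are convex. *)
Record surrounds Omega (S : set R[i]^o) gamma : Prop := Surrounds {
  sr_C1_re : C1_fun (re_path gamma);
  sr_C1_im : C1_fun (im_path gamma);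
  sr_closed : gamma 0 = gamma 1;
  sr_avoids : forall t, 0 <= t <= 1 -> (Omega `\` S) (gamma t);
  sr_inside : forall z, S z -> winding gamma z = 1;
  sr_outside : forall z, ~ Omega z -> winding gamma z = 0 }.

Definition dunford gamma (f : R[i]^o -> R[i]^o) n (T : 'M[R[i]]_n) :
    'M[R[i]]_n :=
  \matrix_(i, j) (inv_2pii R *
    contour_int gamma (fun z => f z * invmx ((z : R[i])%:M - T) i j)).

(* Holomorphic functional calculus: the value of the Dunford integral over a
   contour surrounding the spectrum of T in Omega. By Cauchy's theorem, it does
   not depend on the contour when f is holomorphic on Omega. *)
Definition hol_fc Omega (f : R[i]^o -> R[i]^o) n (T : 'M[R[i]]_n) :
    'M[R[i]]_n :=
  xget 0 [set X | exists2 gamma,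
                    surrounds Omega (spectrum T) gamma & X = dunford gamma f T].

(* Continuous functional calculus of a normal matrix: with
   N = P^-1 *m diag_mx D *m P and P unitary, f(N) = P^-1 *m diag_mx f(D) *m P. *)
Definition normal_fc (f : R[i]^o -> R[i]^o) m (N : 'M[R[i]]_m) : 'M[R[i]]_m :=
  invmx (spectralmx N) *m diag_mx (map_mx f (spectral_diag N))
    *m spectralmx N.

(* The inclusion of H in K is an isometry J, so that P_H = J *m J^t* and the
   compression P_H B |_H, as an operator on H, is J^t* *m B *m J. *)
Definition isometry_mx n m (J : 'M[R[i]]_(m, n)) : Prop := J^t* *m J = 1%:M.

Definition compression n m (J : 'M[R[i]]_(m, n)) (B : 'M[R[i]]_m) :
    'M[R[i]]_n := J^t* *m B *m J.

End Operators.

(* Main.v *)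
Require Import Defs.
From HB Require Import structures.
From mathcomp Require Import all_boot all_order all_algebra sesquilinear spectral.
From mathcomp Require Import all_classical all_reals all_analysis.
From mathcomp Require Import complex.
From mathcomp Require Import measurable_realfun.
From mathcomp Require Import ring lra.

Set Implicit Arguments.
Unset Strict Implicit.
Unset Printing Implicit Defensive.

Import Order.TTheory GRing.Theory Num.Theory.
Import numFieldNormedType.Exports.

Local Open Scope classical_set_scope.
Local Open Scope ring_scope.
Local Open Scope complex_scope.
Local Open Scope sesquilinear_scope.

(* On the boundary curve put M(t) = c(t) + c(t)^* with
   c(t) = (2 pi i)^-1 gamma'(t) (gamma(t) - T)^-1. Convexity and W(T) in Omega
   make this double layer kernel positive, and its total mass is 2. By Cauchy's
   formula on the closure of Omega and by Fubini,
   f(T) + (C f^bar)(T)^* is the integral of f(gamma) M for every f in A(Omega).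
   Riemann sums of the finitely many integrals of M and a_k(gamma) M (a_k a basis
   of A) lie in the cone generated by the vectors (v v^*, a_k(gamma(t)) v v^* )_k of
   a real space of dimension 2 n^2 (d + 1), so by Caratheodory's theorem and
   compactness the integrals are sums of that many generators. Its vectors v and
   nodes gamma(t) give the rows of J and the diagonal matrix N. *)

(** An element of A(Omega) is holomorphic only inside and merely continuous up to the boundary, so
    Goursat's argument cannot run on the boundary itself. Convexity supplies the dilated curves
    [z0 + r (gamma - z0)], which lie in Omega for [r < 1]. Integrals over them do not depend on [r]
    as long as no singularity is crossed, [r -> 1] reaches the boundary by uniform continuity, and
    the same curves serve as Dunford contours around the spectrum. Since [hol_fc] selects an
    arbitrary contour, its link with the boundary integral is proved for all of them.

    The constant function 1 stands beside the basis of A for two reasons: its integral is the mass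
    of the kernel, which makes J an isometry after division by [sqrt 2], and it bounds the vectors
    v, without which there is no compactness. The generators are built on rank-one matrices rather
    than on arbitrary positive ones, so that each node adds one dimension to K instead of n. *)

Local Notation re := (@complex.Re _).
Local Notation im := (@complex.Im _).

(** * Complex numbers by real and imaginary parts *)

Section ComplexParts.
Variable R : realType.
Implicit Types z w : R[i].

Lemma complex_ext z w : re z = re w -> im z = im w -> z = w.
Proof. by case: z => a b; case: w => c d /= -> ->. Qed.

Lemma reD z w : re (z + w) = re z + re w.
Proof. by case: z; case: w. Qed.
Lemma imD z w : im (z + w) = im z + im w.
Proof. by case: z; case: w. Qed.
Lemma reN z : re (- z) = - re z. Proof. by case: z. Qed.
Lemma imN z : im (- z) = - im z. Proof. by case: z. Qed.
Lemma reM z w : re (z * w) = re z * re w - im z * im w.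
Proof. by case: z; case: w. Qed.
Lemma imM z w : im (z * w) = re z * im w + im z * re w.
Proof. by case: z; case: w. Qed.
Lemma reV z : re z^-1 = re z / (re z ^+ 2 + im z ^+ 2).
Proof. by case: z. Qed.
Lemma imV z : im z^-1 = - (im z / (re z ^+ 2 + im z ^+ 2)).
Proof. by case: z => a b; rewrite /= ?mulNr. Qed.
Lemma re0 : re (0 : R[i]) = 0. Proof. by []. Qed.
Lemma im0 : im (0 : R[i]) = 0. Proof. by []. Qed.
Lemma re1 : re (1 : R[i]) = 1. Proof. by []. Qed.
Lemma im1 : im (1 : R[i]) = 0. Proof. by []. Qed.
Lemma reJ z : re (Num.conj z) = re z. Proof. by case: z. Qed.
Lemma imJ z : im (Num.conj z) = - im z. Proof. by case: z. Qed.
Lemma reC (x : R) : re x%:C = x. Proof. by []. Qed.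
Lemma imC (x : R) : im x%:C = 0. Proof. by []. Qed.

Definition partsE := (reD, imD, reN, imN, reM, imM, re0, im0, re1, im1,
  reJ, imJ, reC, imC).

Lemma re_sum (I : Type) (r : seq I) (P : pred I) (F : I -> R[i]) :
  re (\sum_(i <- r | P i) F i) = \sum_(i <- r | P i) re (F i).
Proof. by apply: (big_morph re reD re0). Qed.
Lemma sqr_parts_gt0 z : z != 0 -> 0 < re z ^+ 2 + im z ^+ 2.
Proof.
move=> z0; rewrite lt_def addr_ge0 ?sqr_ge0 // andbT.
apply: contra z0 => h.
have : (re z ^+ 2 == 0) && (im z ^+ 2 == 0) by rewrite -paddr_eq0 ?sqr_ge0.
by rewrite !sqrf_eq0 => /andP[/eqP a /eqP b]; apply/eqP/complex_ext.
Qed.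

(** A real-valued norm equivalent to the modulus, whose values lie in [R[i]]. Estimates made with it
    stay in [R] and split into real and imaginary parts. *)
Definition norm1 z : R := `|re z| + `|im z|.

Lemma norm1_ge0 z : 0 <= norm1 z. Proof. by rewrite addr_ge0. Qed.
Lemma norm1_eq0 z : (norm1 z == 0) = (z == 0).
Proof.
rewrite paddr_eq0 // !normr_eq0; apply/andP/eqP => [[/eqP a /eqP b]|-> //=].
exact: complex_ext.
Qed.
Lemma norm1_gt0 z : (0 < norm1 z) = (z != 0).
Proof. by rewrite lt_def norm1_ge0 andbT norm1_eq0. Qed.
Lemma norm10 : norm1 0 = 0. Proof. by apply/eqP; rewrite norm1_eq0. Qed.
Lemma norm1N z : norm1 (- z) = norm1 z.
Proof. by rewrite /norm1 !partsE !normrN. Qed.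
Lemma norm1D z w : norm1 (z + w) <= norm1 z + norm1 w.
Proof.
rewrite /norm1 !partsE addrACA; apply: lerD; exact: ler_normD.
Qed.
Lemma norm1B z w : norm1 (z - w) = norm1 (w - z).
Proof. by rewrite -norm1N opprB. Qed.
Lemma norm1M z w : norm1 (z * w) <= norm1 z * norm1 w.
Proof.
rewrite /norm1 !partsE.
apply: le_trans (lerD (ler_normB _ _) (ler_normD _ _)) _.
by rewrite !normrM; rewrite le_eqVlt; apply/orP; left; apply/eqP; ring.
Qed.
Lemma norm1Cl (x : R) z : norm1 (x%:C * z) = `|x| * norm1 z.
Proof.
by rewrite /norm1 !partsE !mul0r subr0 addr0 !normrM mulrDr.
Qed.
Lemma re_le_norm1 z : `|re z| <= norm1 z. Proof. by rewrite lerDl. Qed.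
Lemma im_le_norm1 z : `|im z| <= norm1 z. Proof. by rewrite lerDr. Qed.
Lemma norm1_tri w z z' : norm1 (z - z') <= norm1 (z - w) + norm1 (w - z').
Proof. by rewrite -[z - z'](subrKA w) norm1D. Qed.

Lemma norm1_sum (I : Type) (r : seq I) (P : pred I) (F : I -> R[i]) :
  norm1 (\sum_(i <- r | P i) F i) <= \sum_(i <- r | P i) norm1 (F i).
Proof.
elim/big_rec2: _ => [|i x y _ h]; first by rewrite norm10.
by rewrite (le_trans (norm1D _ _)) // lerD2l.
Qed.

Lemma normc_le_norm1 z : `|z| <= (norm1 z)%:C.
Proof.
rewrite normc_def lecR -(ler_pXn2r (n := 2)) ?nnegrE ?sqrtr_ge0 ?norm1_ge0 //.
rewrite sqr_sqrtr ?addr_ge0 ?sqr_ge0 // /norm1 sqrrD !real_normK ?num_real //.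
by rewrite addrAC lerDl mulrn_wge0 // mulr_ge0.
Qed.

Lemma norm1_le_normc z (x : R) : `|z| <= x%:C -> norm1 z <= 2 * x.
Proof.
rewrite normc_def lecR => h.
have hr : `|re z| <= x.
  by apply: le_trans h; rewrite -sqrtr_sqr ler_wsqrtr // lerDl sqr_ge0.
have hi : `|im z| <= x.
  by apply: le_trans h; rewrite -sqrtr_sqr ler_wsqrtr // lerDr sqr_ge0.
by rewrite mulr2n mulrDl mul1r lerD.
Qed.

End ComplexParts.

(** * Uniformity on squares and intervals by bisection *)

Section Bisection.
Variable R : realType.

(* Compactness of the unit square in the form of Cousin's lemma, for squares
   given by a corner and a side. *)
Lemma square_bisection (P : R -> R -> R -> Prop) :
  (forall x y h, 0 < h ->
     P x y (h / 2) -> P (x + h / 2) y (h / 2) -> P x (y + h / 2) (h / 2) ->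
     P (x + h / 2) (y + h / 2) (h / 2) -> P x y h) ->
  (forall p q, 0 <= p <= 1 -> 0 <= q <= 1 -> exists2 e, 0 < e &
     forall x y h, 0 <= x <= p -> p <= x + h <= 1 ->
       0 <= y <= q -> q <= y + h <= 1 -> 0 < h < e -> P x y h) ->
  P 0 0 1.
Proof.
move=> split4 local; apply: contrapT => NP.
have step (s : R * R) h : 0 < h -> ~ P s.1 s.2 h -> exists s' : R * R,
    [/\ ~ P s'.1 s'.2 (h / 2), s.1 <= s'.1 <= s.1 + h / 2
      & s.2 <= s'.2 <= s.2 + h / 2].
  move=> h0 np; apply: contrapT => N; apply: np.
  have H a b : s.1 <= a <= s.1 + h / 2 -> s.2 <= b <= s.2 + h / 2 ->
      P a b (h / 2).
    by move=> ha hb; apply: contrapT => np; apply: N; exists (a, b).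
  by apply: split4 => //; apply: H; apply/andP; split; lra.
pose nxt s h := xget s [set s' : R * R | [/\ ~ P s'.1 s'.2 (h / 2),
  s.1 <= s'.1 <= s.1 + h / 2 & s.2 <= s'.2 <= s.2 + h / 2]].
pose side k : R := 2^-1 ^+ k.
have side0 k : 0 < side k by rewrite exprn_gt0 // invr_gt0.
have sideS k : side k.+1 = side k / 2 by rewrite /side exprSr.
pose u := fix u k := if k is k'.+1 then nxt (u k') (side k') else (0, 0) : R * R.
have uS k : ~ P (u k).1 (u k).2 (side k) -> [/\ ~ P (u k.+1).1 (u k.+1).2 (side k.+1),
    (u k).1 <= (u k.+1).1 <= (u k).1 + side k.+1
    & (u k).2 <= (u k.+1).2 <= (u k).2 + side k.+1].
  by move=> /(step _ _ (side0 k)) [s' hs']; rewrite sideS /= /nxt; case: xgetP;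
    [move=> s _ [] | move=> /(_ s')].
have uN k : ~ P (u k).1 (u k).2 (side k).
  by elim: k => [|k IH]; [rewrite /side expr0 | case: (uS k IH)].
(* In each coordinate the lower ends never decrease and the upper ends [c k + side k] never
   increase, so the supremum of the lower ends lies in all the nested segments. *)
have limit (c : nat -> R) : c 0%N = 0 ->
    (forall k, c k <= c k.+1 <= c k + side k.+1) ->
    exists p, forall k, [/\ 0 <= c k, c k <= p, p <= c k + side k & c k + side k <= 1].
  move=> c0 cS.
  have mono j k : c k <= c (k + j)%N /\ c (k + j)%N + side (k + j)%N <= c k + side k.
    elim: j => [|j [IH1 IH2]]; first by rewrite addn0.
    rewrite addnS; have /andP[h1 h2] := cS (k + j)%N.
    by have := sideS (k + j)%N; split; lra.
  have bnd j k : c j <= c k + side k.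
    have [h1 _] := mono k j; have [_ h2] := mono j k.
    rewrite addnC in h2; have := side0 (j + k)%N; lra.
  exists (sup (range c)) => k.
  have S : has_sup (range c).
    split; first by exists (c 0%N), 0%N.
    by exists (c 0%N + side 0%N) => _ [j _ <-]; exact: bnd.
  have h0 := (mono k 0%N); rewrite add0n c0 /side expr0 add0r in h0.
  split; [by case: h0| | |by case: h0].
    by apply: ub_le_sup; [case: S|exists k].
  by apply: ge_sup; [case: S|move=> _ [j _ <-]; exact: bnd].
have [p hp] : exists p : R, forall k, [/\ 0 <= (u k).1, (u k).1 <= p,
    p <= (u k).1 + side k & (u k).1 + side k <= 1].
  by apply: limit => // k; case: (uS k (uN k)).
have [q hq] : exists q, forall k, [/\ 0 <= (u k).2, (u k).2 <= q,
    q <= (u k).2 + side k & (u k).2 + side k <= 1].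
  by apply: limit => // k; case: (uS k (uN k)).
have [e e0 he] : exists2 e, 0 < e &
     forall x y h, 0 <= x <= p -> p <= x + h <= 1 ->
       0 <= y <= q -> q <= y + h <= 1 -> 0 < h < e -> P x y h.
  have [a1 a2 a3 a4] := hp 0%N; have [b1 b2 b3 b4] := hq 0%N.
  by apply: local; apply/andP; split; lra.
have [k hk] : exists k, side k < e.
  have : (side k @[k --> \oo] --> 0)%classic.
    by apply: cvg_expr; rewrite ger0_norm ?invr_ge0 // invf_lt1 // ltr1n.
  move=> /cvgrPdist_lt /(_ _ e0) [k _ /(_ k (leqnn k))].
  by rewrite /= sub0r normrN gtr0_norm //; exists k.
apply: (uN k); have [a1 a2 a3 a4] := hp k; have [b1 b2 b3 b4] := hq k.
by apply: he; rewrite ?side0; apply/andP; split.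
Qed.

(** The planar version for a predicate that ignores the second coordinate. It takes the place of
    finite subcovers whenever a bound or a modulus of continuity has to be uniform on [0, 1]. *)
Lemma interval_bisection (P : R -> R -> Prop) :
  (forall a b c, a < b -> b < c -> P a b -> P b c -> P a c) ->
  (forall p, 0 <= p <= 1 -> exists2 e, 0 < e &
     forall a b, 0 <= a <= p -> p <= b <= 1 -> 0 < b - a < e -> P a b) ->
  P 0 1.
Proof.
move=> cat local.
suff: P 0 (0 + 1) by rewrite add0r.
apply: (@square_bisection (fun x _ h => P x (x + h))).
  move=> x _ h h0 h1 h2 _ _; apply: cat h1 _; [lra|lra|].
  by rewrite [X in P _ X](_ : _ = x + h / 2 + h / 2) //; lra.
move=> p q hp hq; have [e e0 he] := local p hp; exists e => // x _ h h1 h2 _ _ h3.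
by apply: he => //; rewrite addrC addKr.
Qed.

End Bisection.

(** * Primitives and increments of real functions *)

Section RealCalculus.
Variable R : realType.
Implicit Types (h H : R -> R).
Local Notation mu := (@lebesgue_measure R).

(** The range starts at -1 so that 0 is an interior point: primitives have two-sided derivatives on
    all of [0, 1]. *)
Definition primitive_of h H := forall x : R, -1 < x -> is_derive x (1 : R) H (h x).

Lemma continuous_integrable h {a b : R} : continuous h ->
  mu.-integrable `[a, b] (EFin \o h).
Proof.
move=> ch; apply: continuous_compact_integrable; first exact: segment_compact.
exact: continuous_subspaceT.
Qed.

Lemma exists_primitive h : continuous h -> exists H, primitive_of h H.
Proof.
move=> ch; exists (fun x => \int[mu]_(t in `[-1, x]) h t) => x x1.
have [d e] := @continuous_FTC1_closed R h (-1) x (x + 1) ltac:(by rewrite ltrDl)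
  (continuous_integrable (a := -1) (b := x + 1) ch) x1 (ch x).
apply: DeriveDef; [exact: d|by rewrite -derive1E; exact: e].
Qed.

Lemma primitive_continuous h H : primitive_of h H ->
  forall x, -1 < x -> {for x, continuous H}.
Proof.
move=> hH x x1; apply: differentiable_continuous; apply/derivable1_diffP.
by case: (hH x x1).
Qed.

Lemma integral_primitive h H : continuous h -> primitive_of h H ->
  \int[mu]_(t in `[0, 1]) h t = H 1 - H 0.
Proof.
move=> ch hH; rewrite /Rintegral (@continuous_FTC2 R h H) //.
- exact: continuous_subspaceT.
- split.
  + by move=> x; rewrite in_itv /= => /andP[x0 _]; case: (hH x ltac:(lra)).
  + by apply: cvg_at_right_filter; apply: primitive_continuous hH _ _; lra.
  + by apply: cvg_at_left_filter; apply: primitive_continuous hH _ _; lra.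
- move=> x; rewrite in_itv /= => /andP[x0 _]; rewrite derive1E.
  by have := hH x ltac:(lra) => h0; rewrite derive_val.
Qed.

Lemma increment_bound h H (a b M : R) : a <= b ->
  (forall x, a <= x <= b -> is_derive x (1 : R) H (h x)) ->
  (forall x, a <= x <= b -> `|h x| <= M) -> `|H b - H a| <= M * (b - a).
Proof.
move=> ab hH hM.
have [c] := @MVT_segment R H h a b ab
  ltac:(by move=> x; rewrite in_itv /= => /andP[/ltW ? /ltW ?]; apply: hH; apply/andP)
  ltac:(apply: derivable_within_continuous => x; rewrite in_itv /=;
    by move=> /hH []).
rewrite in_itv /= => cab ->.
by rewrite normrM (ger0_norm (x := b - a)) ?subr_ge0 // ler_wpM2r ?subr_ge0 ?hM.
Qed.

End RealCalculus.

(** * Calculus for complex functions of a real variable *)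

Section ComplexCalculus.
Variable R : realType.
Implicit Types (f g F G : R -> R[i]).
Local Notation mu := (@lebesgue_measure R).

Definition cderiv F (t : R) (D : R[i]) : Prop :=
  is_derive t (1 : R) (fun s => re (F s)) (re D) /\
  is_derive t (1 : R) (fun s => im (F s)) (im D).

Definition ccont (X : topologicalType) (f : X -> R[i]) : Prop :=
  continuous (fun t => re (f t)) /\ continuous (fun t => im (f t)).

Definition cprimitive_of f F := forall t : R, -1 < t -> cderiv F t (f t).

Definition cintegral f : R[i] :=
  (\int[mu]_(t in `[0, 1]) re (f t)) +i* (\int[mu]_(t in `[0, 1]) im (f t)).

Lemma cderivE F t D D' : cderiv F t D -> D = D' -> cderiv F t D'.
Proof. by move=> h <-. Qed.

Lemma eq_cderiv F G t D : F =1 G -> cderiv F t D -> cderiv G t D.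
Proof. by move=> /funext ->. Qed.

Lemma cderiv_cst (c : R[i]) t : cderiv (fun=> c) t 0.
Proof. by split; apply: is_derive_cst. Qed.

Lemma cderiv_real (h : R -> R) (t d : R) :
  is_derive t (1 : R) h d -> cderiv (fun s => (h s)%:C) t d%:C.
Proof. by move=> ?; split => //=; apply: is_derive_cst. Qed.

Lemma cderivD F G t D E : cderiv F t D -> cderiv G t E ->
  cderiv (fun s => F s + G s) t (D + E).
Proof.
move=> [h1 h2] [k1 k2]; split.
  rewrite (_ : (fun s => re (F s + G s)) = (fun s => re (F s)) + (fun s => re (G s))).
    by rewrite reD; apply: is_deriveD.
  by apply/funext => s; rewrite reD.
rewrite (_ : (fun s => im (F s + G s)) = (fun s => im (F s)) + (fun s => im (G s))).
  by rewrite imD; apply: is_deriveD.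
by apply/funext => s; rewrite imD.
Qed.

Lemma cderivM F G t D E : cderiv F t D -> cderiv G t E ->
  cderiv (fun s => F s * G s) t (F t * E + D * G t).
Proof.
move=> [h1 h2] [k1 k2]; split.
  rewrite (_ : (fun s => re (F s * G s)) =
    (fun s => re (F s)) * (fun s => re (G s)) - (fun s => im (F s)) * (fun s => im (G s))).
    apply: is_derive_eq; rewrite !partsE /GRing.scale /=; ring.
  by apply/funext => s; rewrite reM.
rewrite (_ : (fun s => im (F s * G s)) =
  (fun s => re (F s)) * (fun s => im (G s)) + (fun s => im (F s)) * (fun s => re (G s))).
  apply: is_derive_eq; rewrite !partsE /GRing.scale /=; ring.
by apply/funext => s; rewrite imM.
Qed.

Lemma cderivN F t D : cderiv F t D -> cderiv (fun s => - F s) t (- D).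
Proof.
move=> h; have := cderivM (cderiv_cst (-1) t) h.
rewrite mul0r addr0 mulN1r; apply: eq_cderiv => s; exact: mulN1r.
Qed.

Lemma cderivB F G t D E : cderiv F t D -> cderiv G t E ->
  cderiv (fun s => F s - G s) t (D - E).
Proof. by move=> h k; apply: cderivD => //; apply: cderivN. Qed.

Lemma cderivMl (c : R[i]) F t D : cderiv F t D ->
  cderiv (fun s => c * F s) t (c * D).
Proof.
move=> h; apply: cderivE (cderivM (cderiv_cst c t) h) _.
by rewrite mul0r addr0.
Qed.

Lemma is_deriveV_real (f : R -> R) (x df : R) : f x != 0 ->
  is_derive x (1 : R) f df ->
  is_derive x (1 : R) (fun y => (f y)^-1) (- (f x) ^- 2 * df).
Proof.
move=> fx0 hf; apply: DeriveDef; first by apply: derivableV => //; case: hf.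
rewrite deriveV //.
by rewrite derive_val.
Qed.

Lemma cderivV F t D : F t != 0 -> cderiv F t D ->
  cderiv (fun s => (F s)^-1) t (- D / (F t) ^+ 2).
Proof.
move=> F0 [h1 h2].
have n0 := lt0r_neq0 (sqr_parts_gt0 F0).
pose q := (fun s => re (F s)) ^+ 2 + (fun s => im (F s)) ^+ 2.
have qE s : q s = re (F s) ^+ 2 + im (F s) ^+ 2 by [].
have hq : is_derive t (1 : R) q (2 * (re (F t) * re D + im (F t) * im D)).
  apply: (is_derive_eq (is_deriveD (is_deriveX 2 h1) (is_deriveX 2 h2))).
  by rewrite /GRing.scale /= expr1; ring.
have hV := @is_deriveV_real q t _ n0 hq.
have E1 : re (- D / F t ^+ 2) = (- (re D) * (re (F t) ^+ 2 - im (F t) ^+ 2)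
    - im D * (2 * re (F t) * im (F t))) / (re (F t) ^+ 2 + im (F t) ^+ 2) ^+ 2.
  rewrite expr2 !(partsE, reV, imV).
  move: (re (F t)) (im (F t)) (re D) (im D) n0 => a b c d n0.
  have n1 : (a * a - b * b) ^+ 2 + (a * b + b * a) ^+ 2 != 0.
    by rewrite [X in X != 0](_ : _ = (a ^+ 2 + b ^+ 2) ^+ 2) ?expf_neq0 //; ring.
  by field; rewrite n1 n0.
have E2 : im (- D / F t ^+ 2) = (- im D * (re (F t) ^+ 2 - im (F t) ^+ 2)
    + re D * (2 * re (F t) * im (F t))) / (re (F t) ^+ 2 + im (F t) ^+ 2) ^+ 2.
  rewrite expr2 !(partsE, reV, imV).
  move: (re (F t)) (im (F t)) (re D) (im D) n0 => a b c d n0.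
  have n1 : (a * a - b * b) ^+ 2 + (a * b + b * a) ^+ 2 != 0.
    by rewrite [X in X != 0](_ : _ = (a ^+ 2 + b ^+ 2) ^+ 2) ?expf_neq0 //; ring.
  by field; rewrite n1 n0.
split.
  rewrite E1 (_ : (fun s => re (F s)^-1) = (fun s => re (F s)) * (fun s => (q s)^-1)).
    apply: (is_derive_eq (is_deriveM h1 hV)).
    by rewrite /GRing.scale /= qE; field.
  by apply/funext => s; rewrite reV.
rewrite E2 (_ : (fun s => im (F s)^-1) = - ((fun s => im (F s)) * (fun s => (q s)^-1))).
  apply: (is_derive_eq (is_deriveN (is_deriveM h2 hV))).
  by rewrite /GRing.scale /= qE; field.
by apply/funext => s; rewrite imV.
Qed.

Lemma cderivX F t D k : cderiv F t D ->
  cderiv (fun s => F s ^+ k) t (k%:R * F t ^+ k.-1 * D).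
Proof.
move=> h; elim: k => [|k IH].
  by rewrite !mul0r; under eq_fun do rewrite expr0; apply: cderiv_cst.
under eq_fun do rewrite exprS.
apply: cderivE (cderivM h IH) _.
case: k IH => [|k] _; first by rewrite expr0 !mul0r mulr0 add0r mulrC !mul1r.
by rewrite -(natr1 k.+1) /= !exprS; ring.
Qed.

Section Continuity.
Variable X : topologicalType.

Lemma ccont_cst (c : R[i]) : ccont (fun _ : X => c).
Proof. by split => x; apply: cst_continuous. Qed.

Lemma ccont_real (h : X -> R) : continuous h -> ccont (fun t => (h t)%:C).
Proof. by move=> ch; split => //= x; apply: cst_continuous. Qed.

Lemma contD (h k : X -> R) : continuous h -> continuous k ->
  continuous (fun t => h t + k t).
Proof. by move=> ch ck x; exact: (continuousD (ch x) (ck x)). Qed.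

Lemma contB (h k : X -> R) : continuous h -> continuous k ->
  continuous (fun t => h t - k t).
Proof. by move=> ch ck x; exact: (continuousB (ch x) (ck x)). Qed.

Lemma contM (h k : X -> R) : continuous h -> continuous k ->
  continuous (fun t => h t * k t).
Proof. by move=> ch ck x; exact: (continuousM (ch x) (ck x)). Qed.

Lemma contN (h : X -> R) : continuous h -> continuous (fun t => - h t).
Proof. by move=> ch x; exact: (continuousN (ch x)). Qed.

Lemma ccontD (f g : X -> R[i]) : ccont f -> ccont g -> ccont (fun t => f t + g t).
Proof.
move=> [h1 h2] [k1 k2]; split.
  by under eq_fun do rewrite reD; apply: contD.
by under eq_fun do rewrite imD; apply: contD.
Qed.

Lemma ccontN (f : X -> R[i]) : ccont f -> ccont (fun t => - f t).
Proof.
move=> [h1 h2]; split; first by under eq_fun do rewrite reN; apply: contN.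
by under eq_fun do rewrite imN; apply: contN.
Qed.

Lemma ccontB (f g : X -> R[i]) : ccont f -> ccont g -> ccont (fun t => f t - g t).
Proof. by move=> h k; apply: ccontD => //; apply: ccontN. Qed.

Lemma ccontJ (f : X -> R[i]) : ccont f -> ccont (fun t => Num.conj (f t)).
Proof.
move=> [h1 h2]; split; first by under eq_fun do rewrite reJ.
by under eq_fun do rewrite imJ; apply: contN.
Qed.

Lemma ccontM (f g : X -> R[i]) : ccont f -> ccont g -> ccont (fun t => f t * g t).
Proof.
move=> [h1 h2] [k1 k2]; split.
  by under eq_fun do rewrite reM; apply: contB; apply: contM.
by under eq_fun do rewrite imM; apply: contD; apply: contM.
Qed.

Lemma ccontV (f : X -> R[i]) : (forall t, f t != 0) -> ccont f -> ccont (fun t => (f t)^-1).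
Proof.
move=> f0 [h1 h2].
have cq : continuous (fun t => (re (f t) ^+ 2 + im (f t) ^+ 2)^-1).
  have cn : continuous (fun t => re (f t) ^+ 2 + im (f t) ^+ 2).
    by under eq_fun do rewrite !expr2; apply: contD; apply: contM.
  by move=> x; apply: (@continuousV R X (fun t => re (f t) ^+ 2 + im (f t) ^+ 2) x
    (lt0r_neq0 (sqr_parts_gt0 (f0 x))) (cn x)).
split.
  by under eq_fun do rewrite reV; apply: contM.
by under eq_fun do rewrite imV; apply: contN; apply: contM.
Qed.

Lemma ccont_sum (I : Type) (r : seq I) (P : pred I) (F : I -> X -> R[i]) :
  (forall i, P i -> ccont (F i)) -> ccont (fun t => \sum_(i <- r | P i) F i t).
Proof.
move=> h; elim: r => [|i r IH].
  by under eq_fun do rewrite big_nil; apply: ccont_cst.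
under eq_fun do rewrite big_cons.
case: (boolP (P i)) => [Pi|_]; last exact: IH.
by apply: ccontD => //; exact: h.
Qed.

End Continuity.
Arguments ccont_cst {X} c.

Lemma ccont_comp (X Y : topologicalType) (f : X -> R[i]) (h : Y -> X) :
  ccont f -> continuous h -> ccont (fun t => f (h t)).
Proof.
move=> [f1 f2] ch; split => x.
  exact: (@continuous_comp _ _ _ h (fun s => re (f s)) x (ch x) (f1 (h x))).
exact: (@continuous_comp _ _ _ h (fun s => im (f s)) x (ch x) (f2 (h x))).
Qed.

Lemma cderiv_ccont F D : (forall t, cderiv F t (D t)) -> ccont F.
Proof.
move=> h; split => x; apply: differentiable_continuous; apply/derivable1_diffP.
  by case: (h x) => -[].
by case: (h x) => _ [].
Qed.

Lemma ccontP f : ccont f <-> forall t e, 0 < e ->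
  exists2 d, 0 < d & forall s, `|s - t| < d -> norm1 (f s - f t) < e.
Proof.
split=> [[h1 h2] t e e0|h].
  have e2 : 0 < e / 2 by lra.
  have /cvgrPdist_lt/(_ _ e2)/nbhs_ballP[d1 /= d10 H1] := h1 t.
  have /cvgrPdist_lt/(_ _ e2)/nbhs_ballP[d2 /= d20 H2] := h2 t.
  exists (Num.min d1 d2); first by rewrite lt_min d10.
  move=> s; rewrite lt_min distrC => /andP[s1 s2].
  have := H1 s s1; have := H2 s s2; rewrite /= distrC => k2; rewrite distrC => k1.
  rewrite /norm1 !partsE; lra.
split => t; apply/cvgrPdist_lt => e e0; have [d d0 hd] := h t e e0;
  apply/nbhs_ballP; exists d => //= s; rewrite /ball /= distrC => /hd /(le_lt_trans _) k;
  rewrite distrC.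
  by apply: k; rewrite -reN -reD re_le_norm1.
by apply: k; rewrite -imN -imD im_le_norm1.
Qed.

Lemma ccont_bounded f : ccont f ->
  exists2 K, 0 < K & forall t, 0 <= t <= 1 -> norm1 (f t) <= K.
Proof.
move=> /ccontP cf.
apply: (@interval_bisection R (fun a b => exists2 K, 0 < K &
  forall t, a <= t <= b -> norm1 (f t) <= K)).
  move=> a b c ab bc [K K0 hK] [K' K'0 hK']; exists (K + K'); first exact: addr_gt0.
  move=> t /andP[ta tc]; have [tb|tb] := leP t b.
    by apply: (le_trans (hK t _)); rewrite ?ta // lerDl ltW.
  by apply: (le_trans (hK' t _)); rewrite ?(ltW tb) // lerDr ltW.
move=> p _; have [d d0 hd] := cf p 1 ltr01; exists d => // a b ap pb bad.
exists (norm1 (f p) + 1); first by rewrite ltr_wpDl ?norm1_ge0.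
move=> t atb; have := hd t; rewrite -[f t](subrK (f p)) [_ + 1]addrC addrK => k.
apply: (le_trans (norm1D _ _)); rewrite lerD2r ltW // k // ltr_norml.
by apply/andP; split; lra.
Qed.

Lemma exists_cprimitive f : ccont f -> exists F, cprimitive_of f F.
Proof.
move=> [h1 h2]; have [F hF] := exists_primitive h1; have [G hG] := exists_primitive h2.
by exists (fun t => F t +i* G t) => t t0; split; [exact: hF|exact: hG].
Qed.

Lemma cintegral_primitive f F : ccont f -> cprimitive_of f F ->
  cintegral f = F 1 - F 0.
Proof.
move=> [h1 h2] hF; apply: complex_ext; rewrite !partsE /=.
  apply: (integral_primitive (H := fun t => re (F t)) h1) => t t0; by case: (hF t t0).
apply: (integral_primitive (H := fun t => im (F t)) h2) => t t0; by case: (hF t t0).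
Qed.

(** The mean value theorem fails for complex values; it is applied to each part separately, at the
    price of the factor 2. *)
Lemma cincrement_bound f F (a b M : R) : a <= b ->
  (forall x, a <= x <= b -> cderiv F x (f x)) ->
  (forall x, a <= x <= b -> norm1 (f x) <= M) ->
  norm1 (F b - F a) <= 2 * (M * (b - a)).
Proof.
move=> ab hF hM; rewrite /norm1 !partsE mulr2n mulrDl mul1r; apply: lerD.
  apply: (@increment_bound _ (fun t => re (f t)) (fun t => re (F t))) => //.
    by move=> x /hF [].
  by move=> x /hM; apply: le_trans; exact: re_le_norm1.
apply: (@increment_bound _ (fun t => im (f t)) (fun t => im (F t))) => //.
  by move=> x /hF [].
by move=> x /hM; apply: le_trans; exact: im_le_norm1.
Qed.

Lemma cintegral_bound f (M : R) : ccont f ->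
  (forall x, 0 <= x <= 1 -> norm1 (f x) <= M) -> norm1 (cintegral f) <= 2 * M.
Proof.
move=> cf hM; have [F hF] := exists_cprimitive cf.
rewrite (cintegral_primitive cf hF).
have := @cincrement_bound f F 0 1 M; rewrite subr0 mulr1; apply => //.
by move=> x /andP[x0 _]; apply: hF; rewrite (lt_le_trans _ x0) // ltrN10.
Qed.

Lemma eq_cintegral f g : (forall t, 0 <= t <= 1 -> f t = g t) ->
  cintegral f = cintegral g.
Proof.
move=> h; rewrite /cintegral; congr (_ +i* _); apply: eq_Rintegral => x;
  by rewrite inE /= in_itv /= => /h ->.
Qed.

Lemma cintegralD f g : ccont f -> ccont g ->
  cintegral (fun t => f t + g t) = cintegral f + cintegral g.
Proof.
move=> cf cg; have [F hF] := exists_cprimitive cf; have [G hG] := exists_cprimitive cg.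
rewrite (cintegral_primitive cf hF) (cintegral_primitive cg hG).
rewrite (@cintegral_primitive _ (fun t => F t + G t)); first by ring.
  exact: ccontD.
by move=> t t0; apply: cderivD; [exact: hF|exact: hG].
Qed.

Lemma cintegralMl c f : ccont f -> cintegral (fun t => c * f t) = c * cintegral f.
Proof.
move=> cf; have [F hF] := exists_cprimitive cf.
rewrite (cintegral_primitive cf hF) (@cintegral_primitive _ (fun t => c * F t)).
- by rewrite mulrBr.
- by apply: ccontM => //; apply: ccont_cst.
- by move=> t t0; apply: cderivMl; exact: hF.
Qed.

Lemma cintegralB f g : ccont f -> ccont g ->
  cintegral (fun t => f t - g t) = cintegral f - cintegral g.
Proof.
move=> cf cg; rewrite -[- cintegral g]mulN1r -cintegralMl // -cintegralD //; last first.
  by apply: ccontM => //; apply: ccont_cst.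
by apply: eq_cintegral => t _; rewrite mulN1r.
Qed.

Lemma cintegral_cst c : cintegral (fun=> c) = c.
Proof.
rewrite (@cintegral_primitive _ (fun t => c * t%:C)); last 2 first.
- exact: ccont_cst.
- move=> t _; apply: cderivE (cderivMl c (cderiv_real (is_derive_id t 1))) _.
  exact: mulr1.
by rewrite !rmorph1 !rmorph0 mulr0 mulr1 subr0.
Qed.

Lemma cintegral_sum (I : Type) (r : seq I) (P : pred I) (F : I -> R -> R[i]) :
  (forall i, P i -> ccont (F i)) ->
  cintegral (fun t => \sum_(i <- r | P i) F i t) = \sum_(i <- r | P i) cintegral (F i).
Proof.
move=> h; elim: r => [|i r IH].
  rewrite big_nil -[RHS]cintegral_cst; apply: eq_cintegral => t _; exact: big_nil.
rewrite big_cons; case: (boolP (P i)) => [Pi|nP]; last first.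
  by rewrite -IH; apply: eq_cintegral => t _; rewrite big_cons (negbTE nP).
rewrite -IH -cintegralD; [|exact: h|exact: ccont_sum].
by apply: eq_cintegral => t _; rewrite big_cons Pi.
Qed.

Lemma cintegralJ f : ccont f ->
  cintegral (fun t => Num.conj (f t)) = Num.conj (cintegral f).
Proof.
move=> cf; have [F hF] := exists_cprimitive cf.
rewrite (cintegral_primitive cf hF) (@cintegral_primitive _ (fun t => Num.conj (F t))).
- by rewrite rmorphB.
- exact: ccontJ.
- move=> t t0; case: (hF t t0) => h1 h2; split.
    by under eq_fun do rewrite reJ; rewrite reJ.
  under eq_fun do rewrite imJ; rewrite imJ; exact: is_deriveN.
Qed.

(* A function that is only continuous on [0, 1] is replaced by its
   composition with [clamp], which is continuous on the whole line. *)
Definition clamp (a b t : R) : R := Num.max a (Num.min b t).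

Lemma clamp_itv a b t : a <= b -> a <= clamp a b t <= b.
Proof.
by move=> ab; rewrite /clamp le_max lexx /= ge_max ab ge_min lexx.
Qed.

Lemma clamp_id a b t : a <= t <= b -> clamp a b t = t.
Proof. by move=> /andP[h1 h2]; rewrite /clamp min_r ?max_r. Qed.

Lemma clamp_continuous a b : continuous (clamp a b).
Proof.
move=> x; apply: (@continuous_max R R (fun=> a) (fun t => Num.min b t) x).
  exact: cst_continuous.
apply: (@continuous_min R R (fun=> b) id x); [exact: cst_continuous|exact: cvg_id].
Qed.

Lemma ccont_clamp f (a b : R) : ccont f -> ccont (fun t => f (clamp a b t)).
Proof. by move=> cf; apply: ccont_comp cf _; exact: clamp_continuous. Qed.

Lemma cintegral_clamp f : cintegral (fun t => f (clamp 0 1 t)) = cintegral f.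
Proof. by apply: eq_cintegral => t ht; rewrite clamp_id. Qed.

End ComplexCalculus.
Arguments ccont_cst {R X} c.

(** * The topology of the complex plane *)

Section ComplexTopology.
Variable R : realType.
Implicit Types (Omega A : set R[i]^o) (z w : R[i]).

Lemma gt0_complex (e : R[i]) : 0 < e -> exists2 d : R, 0 < d & e = d%:C.
Proof.
rewrite ltcE /= => /andP[/eqP i0 r0]; exists (re e) => //.
exact: complex_ext.
Qed.

Lemma ball_norm1 z w (e : R) : norm1 (w - z) < e -> ball (z : R[i]^o) e%:C w.
Proof.
move=> h; rewrite -ball_normE /= distrC; apply: le_lt_trans (normc_le_norm1 _) _.
by rewrite ltcR.
Qed.

Lemma nbhs_norm1 z A : nbhs (z : R[i]^o) A ->
  exists2 d : R, 0 < d & forall w, norm1 (w - z) < d -> A w.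
Proof.
move=> /nbhs_ballP[e /= /gt0_complex[d d0 ->]] h; exists d => // w hw.
exact/h/ball_norm1.
Qed.

Lemma norm1_nbhs z (d : R) : 0 < d -> nbhs (z : R[i]^o) [set w | norm1 (w - z) < d].
Proof.
move=> d0; apply/nbhs_ballP; exists (d / 3)%:C; first by rewrite /= ltcR; lra.
move=> w; rewrite -ball_normE /= distrC => /ltW /norm1_le_normc; lra.
Qed.

Lemma open_norm1 Omega z : open Omega -> Omega z ->
  exists2 d : R, 0 < d & forall w, norm1 (w - z) < d -> Omega w.
Proof. by move=> oO Oz; apply: nbhs_norm1; exact: open_nbhs_nbhs. Qed.

Lemma closure_norm1 Omega z (d : R) : closure Omega (z : R[i]^o) -> 0 < d ->
  exists2 w, Omega w & norm1 (w - z) < d.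
Proof. by move=> h d0; have [w [? ?]] := h _ (norm1_nbhs z d0); exists w. Qed.

(** Differentiability with an explicit remainder. It includes [w = z], so no quotient appears in
    Goursat's estimate. *)
Definition cdiff (f : R[i] -> R[i]) z D :=
  forall e : R, 0 < e -> exists2 d : R, 0 < d & forall w, norm1 (w - z) < d ->
    norm1 (f w - f z - D * (w - z)) <= e * norm1 (w - z).

Lemma derivable_cdiff (f : R[i]^o -> R[i]^o) z : derivable f z 1 ->
  exists D, cdiff f z D.
Proof.
move=> /cvg_ex[D /= hD]; exists D => e e0.
have e3 : 0 < (e / 3)%:C by rewrite ltcR; lra.
move/cvgrPdist_lt/(_ _ e3): hD => /nbhs_norm1[d d0 hd]; exists d => // w hw.
have [->|wz] := eqVneq w z; first by rewrite !subrr mulr0 subrr norm10 mulr0.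
have wz0 : w - z != 0 by rewrite subr_eq0.
have := hd (w - z); rewrite subr0 => /(_ hw) /= /(_ wz0).
rewrite /= /GRing.scale /= mulr1 subrK => /ltW /norm1_le_normc h.
rewrite (_ : f w - f z - D * (w - z) = ((w - z)^-1 * (f w - f z) - D) * (w - z)).
  apply: le_trans (norm1M _ _) _; apply: ler_wpM2r; first exact: norm1_ge0.
  rewrite norm1B; apply: le_trans h _; lra.
by rewrite mulrBl mulrAC mulVf // mul1r.
Qed.

Definition ccont_within A (f : R[i] -> R[i]) z :=
  forall e : R, 0 < e -> exists2 d : R, 0 < d & forall w, A w -> norm1 (w - z) < d ->
    norm1 (f w - f z) < e.

Lemma within_ccont A (f : R[i]^o -> R[i]^o) z : {within A, continuous f} -> A z ->
  ccont_within A f z.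
Proof.
move=> /subspace_continuousP h Az e e0.
have e3 : 0 < (e / 3)%:C by rewrite ltcR; lra.
have /cvgrPdist_lt/(_ _ e3) := h z Az.
move=> /nbhs_norm1[d d0 hd]; exists d => // w Aw hw.
have /= /(_ Aw) := hd w hw; rewrite distrC => /ltW /norm1_le_normc; lra.
Qed.

Lemma convex_combination Omega (r : R) z w : convex_set Omega -> Omega z -> Omega w ->
  0 <= r <= 1 -> Omega (r%:C * z + (1 - r)%:C * w).
Proof.
move=> cO Oz Ow /andP[r0 r1].
have h0 : 0 <= r%:C by rewrite ler0c.
have h1 : r%:C <= 1 by rewrite -(rmorph1 (real_complex R)) lecR.
have := cO z w (Itv01 h0 h1); rewrite !inE => /(_ Oz Ow).
congr (Omega _).
by rewrite rmorphB rmorph1.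
Qed.

(** Replace [w] by a nearby [w'] in Omega and let [z] absorb the error: [z + r (w - z)] equals
    [r w' + (1 - r) z'] with [z' = z + r / (1 - r) (w - w')], and [z'] stays in Omega because Omega
    is open. *)
Lemma segment_interior Omega (r : R) z w : open Omega -> convex_set Omega ->
  Omega z -> closure Omega w -> 0 <= r < 1 -> Omega (z + r%:C * (w - z)).
Proof.
move=> oO cO Oz Ow /andP[r0 r1].
have [d d0 hd] := open_norm1 oO Oz.
have h1r : 0 < 1 - r by lra.
have [w' Ow' hw'] := closure_norm1 Ow (mulr_gt0 d0 h1r).
pose c : R[i] := (r / (1 - r))%:C.
have Oz' : Omega (z + c * (w - w')).
  apply: hd; rewrite addrAC subrr add0r norm1Cl ger0_norm; last first.
    by rewrite divr_ge0 // ltW.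
  rewrite norm1B mulrAC ltr_pdivrMr //.
  by apply: le_lt_trans hw'; rewrite ler_piMl ?norm1_ge0 // ltW.
have := @convex_combination Omega r w' _ cO Ow' Oz' ltac:(by rewrite r0 ltW).
rewrite mulrDr mulrA /c -rmorphM [(1 - r) * _]mulrC divfK ?lt0r_neq0 //.
by congr (Omega _); rewrite rmorphB rmorph1; ring.
Qed.

End ComplexTopology.

(** * Goursat's theorem for a dilated curve *)

Section Homotopy.
Variable R : realType.

Lemma cdiff_continuous (F : R[i] -> R[i]) z D (e : R) : cdiff F z D -> 0 < e ->
  exists2 d : R, 0 < d & forall w, norm1 (w - z) < d -> norm1 (F w - F z) < e.
Proof.
move=> hF e0; have [d d0 hd] := hF 1 ltr01.
pose c := 1 + norm1 D.
have c0 : 0 < c by rewrite ltr_pwDl ?norm1_ge0.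
exists (Num.min d (e / c)); first by rewrite lt_min d0 divr_gt0.
move=> w; rewrite lt_min => /andP[h1]; rewrite ltr_pdivlMr // /c mulrDr => h2.
have := hd _ h1; have := norm1D (F w - F z - D * (w - z)) (D * (w - z)).
have := norm1M D (w - z); rewrite subrK; lra.
Qed.

Lemma ccont_cdiff (F : R[i] -> R[i]) (p : R -> R[i]) : ccont p ->
  (forall t, exists D, cdiff F (p t) D) -> ccont (fun t => F (p t)).
Proof.
move=> /ccontP cp hF; apply/ccontP => t e e0; have [D hD] := hF t.
have [d d0 hd] := cdiff_continuous hD e0; have [d' d'0 hd'] := cp t d d0.
by exists d' => // s hs; apply/hd/hd'.
Qed.

Lemma dist_itv (x h s p : R) : x <= s <= x + h -> x <= p <= x + h -> `|s - p| <= h.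
Proof. by move=> /andP[? ?] /andP[? ?]; rewrite ler_norml; apply/andP; split; lra. Qed.

Variables (g g' : R -> R[i]) (z0 : R[i]).
Hypothesis dg : forall t, cderiv g t (g' t).
Hypothesis cg' : ccont g'.
Hypothesis g01 : g 0 = g 1.

(** The contraction of the curve to [z0]. When the curve bounds a convex domain containing [z0], all
    stages with [0 <= r < 1] lie inside. *)
Definition dilate (r t : R) : R[i] := z0 + r%:C * (g t - z0).

Lemma cderiv_dilate r t : cderiv (dilate r) t (r%:C * g' t).
Proof.
apply: cderivE (cderivD (cderiv_cst z0 t) (cderivMl _ (cderivB (dg t) (cderiv_cst z0 t)))) _.
by rewrite subr0 add0r.
Qed.

Lemma cderiv_dilate_radius (h : R -> R) dh s t : is_derive s (1 : R) h dh ->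
  cderiv (fun s => dilate (h s) t) s (dh%:C * (g t - z0)).
Proof.
move=> hh; apply: cderivE (cderivD (cderiv_cst z0 s)
  (cderivM (cderiv_real hh) (cderiv_cst (g t - z0) s))) _.
by rewrite mulr0 !add0r.
Qed.

Lemma ccont_dilate r : ccont (dilate r).
Proof. exact: cderiv_ccont (cderiv_dilate r). Qed.

(* Goursat's bisection argument, on the parameter rectangle. *)
Lemma homotopy_invariance (F : R[i] -> R[i]) (r1 r2 : R) :
  0 <= r1 -> r1 <= r2 -> r2 <= 1 ->
  (forall r t, r1 <= r <= r2 -> exists D, cdiff F (dilate r t) D) ->
  cintegral (fun t => F (dilate r1 t) * (r1%:C * g' t)) =
  cintegral (fun t => F (dilate r2 t) * (r2%:C * g' t)).
Proof.
move=> r10 r12 r21 hF; pose L := r2 - r1; pose rho s := r1 + L * s.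
have L01 : 0 <= L <= 1 by rewrite /L; lra.
have rho_itv s : 0 <= s <= 1 -> r1 <= rho s <= r2.
  move=> /andP[s0 s1]; rewrite /rho lerDl mulr_ge0 /=; [|by case/andP: L01|by []].
  rewrite -lerBrDl -[leRHS]mulr1; apply: ler_wpM2l => //; by case/andP: L01.
have rho01 s : 0 <= s <= 1 -> 0 <= rho s <= 1.
  by move=> /rho_itv/andP[h1 h2]; rewrite (le_trans r10 h1) (le_trans h2 r21).
(* [F] is controlled only for radii between [r1] and [r2]. Clamping the parameter makes the
   integrands continuous on the whole line, as [exists_cprimitive] requires. *)
pose cl := clamp (R := R) 0 1.
have cl_itv s : 0 <= cl s <= 1 by apply: clamp_itv; exact: ler01.
have crho : continuous (fun s => rho (cl s)).
  move=> s; apply: (contD (h := fun=> r1)); first by move=> ?; exact: cst_continuous.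
  apply: (contM (h := fun=> L)); first by move=> ?; exact: cst_continuous.
  exact: clamp_continuous.
have drho s : is_derive s (1 : R) rho L.
  apply: (is_derive_eq (is_deriveD (is_derive_cst r1 s 1)
    (is_deriveZ L (is_derive_id s 1)))).
  by rewrite add0r /GRing.scale /= mulr1.
have cA x : ccont (fun t => F (dilate (rho (cl x)) t) * ((rho (cl x))%:C * g' t)).
  apply: ccontM; last by apply: ccontM => //; exact: ccont_cst.
  apply: ccont_cdiff; first exact: ccont_dilate.
  by move=> t; apply: hF; exact: rho_itv.
have cB y : ccont (fun s => F (dilate (rho (cl s)) y) * (L%:C * (g y - z0))).
  apply: ccontM; last exact: ccont_cst.
  apply: ccont_cdiff; last by move=> s; apply: hF; exact: rho_itv.
  apply: ccontD; first exact: ccont_cst.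
  by apply: ccontM; [exact: ccont_real|exact: ccont_cst].
have [A hA] := choice (fun x => exists_cprimitive (cA x)).
have [B hB] := choice (fun y => exists_cprimitive (cB y)).
(* [psi x y h] is the integral of [F dz] around the image of the parameter square of corner [(x, y)]
   and side [h]: [A] integrates along the curves of fixed radius, [B] along the rays of fixed
   parameter. *)
pose psi x y h := A (x + h) (y + h) - A (x + h) y - (A x (y + h) - A x y)
  - (B (y + h) (x + h) - B (y + h) x - (B y (x + h) - B y x)).
have cgz : ccont (fun t => g t - z0).
  by apply: ccontB; [exact: cderiv_ccont dg|exact: ccont_cst].
have [K1 K10 hK1] := ccont_bounded cgz; have [K2 K20 hK2] := ccont_bounded cg'.
pose K := K1 + K2; have K0 : 0 < K by exact: addr_gt0.
have bg t : 0 <= t <= 1 -> norm1 (g t - z0) <= K.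
  by move=> /hK1 /le_trans; apply; rewrite lerDl ltW.
have bg' t : 0 <= t <= 1 -> norm1 (g' t) <= K.
  by move=> /hK2 /le_trans; apply; rewrite lerDr ltW.
have lip_g s t : 0 <= s <= 1 -> 0 <= t <= 1 -> norm1 (g s - g t) <= 2 * (K * `|s - t|).
  wlog st : s t / t <= s => [W|] hs ht.
    have [st|/ltW st] := leP t s; first exact: W.
    by rewrite norm1B distrC; exact: W.
  rewrite ger0_norm ?subr_ge0 //; apply: cincrement_bound => // x hx.
  by apply: bg'; apply/andP; split; lra.
(* The constant [3 * K] is [K] for the change of radius, as [L <= 1], plus [2 * K] for the move
   along the curve, by [lip_g]. *)
have lip x y p q h : 0 <= x <= 1 -> 0 <= y <= 1 -> 0 <= p <= 1 -> 0 <= q <= 1 ->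
    `|x - p| <= h -> `|y - q| <= h ->
    norm1 (dilate (rho x) y - dilate (rho p) q) <= 3 * K * h.
  move=> hx hy hp hq xp yq.
  have -> : dilate (rho x) y - dilate (rho p) q =
      (L * (x - p))%:C * (g y - z0) + (rho p)%:C * (g y - g q).
    by rewrite /dilate /rho !rmorphD !rmorphM rmorphB /=; ring.
  have /andP[rp0 rp1] := rho01 p hp.
  have h1 := norm1D ((L * (x - p))%:C * (g y - z0)) ((rho p)%:C * (g y - g q)).
  rewrite !norm1Cl normrM (ger0_norm (x := L)) ?(ger0_norm (x := rho p)) // in h1; last first.
    by case/andP: L01.
  apply: le_trans h1 _.
  have -> : 3 * K * h = 1 * h * K + 1 * (2 * (K * h)) by ring.
  have h0 : 0 <= h by exact: le_trans yq.
  have [L0 L1] := andP L01.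
  apply: lerD.
    apply: ler_pM; [by rewrite mulr_ge0|exact: norm1_ge0| |exact: bg].
    by apply: ler_pM.
  apply: ler_pM => //; first exact: norm1_ge0.
  apply: le_trans (lip_g _ _ hy hq) _.
  by rewrite !ler_pM2l.
have psi_le (e : R) : 0 < e -> norm1 (psi 0 0 1) <= e * 1 * 1.
  move=> e0; apply: (@square_bisection R (fun x y h => norm1 (psi x y h) <= e * h * h)).
    move=> x y h h0 p1 p2 p3 p4.
    have hh : h / 2 + h / 2 = h by lra.
    have -> : psi x y h = psi x y (h / 2) + psi (x + h / 2) y (h / 2) +
        psi x (y + h / 2) (h / 2) + psi (x + h / 2) (y + h / 2) (h / 2).
      rewrite /psi -!addrA !hh; ring.
    have -> : e * h * h = e * (h / 2) * (h / 2) + e * (h / 2) * (h / 2) +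
      e * (h / 2) * (h / 2) + e * (h / 2) * (h / 2) by field.
    apply: le_trans (norm1D _ _) _; apply: lerD p4.
    apply: le_trans (norm1D _ _) _; apply: lerD p3.
    by apply: le_trans (norm1D _ _) _; apply: lerD.
  move=> p q hp hq; pose w := dilate (rho p) q.
  have [D hD] := hF (rho p) q (rho_itv p hp).
  (* Each of the four sides contributes at most [2 * (e' * (3 * K * h) * K * h)], which is
     [6 e' K^2 h^2]; together they give [e * h * h]. *)
  pose e' := e / (24 * K ^+ 2).
  have e'0 : 0 < e' by rewrite divr_gt0 // mulr_gt0 // exprn_gt0.
  have [d d0 hd] := hD e' e'0.
  exists (d / (3 * K)); first by rewrite divr_gt0 // mulr_gt0.
  move=> x y h /andP[x0 xp] /andP[px x1] /andP[y0 yq] /andP[qy y1] /andP[h0].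
  rewrite ltr_pdivlMr ?mulr_gt0 // mulrC => hd3.
  have s01 s : x <= s <= x + h -> 0 <= s <= 1.
    by move=> /andP[xs sx]; rewrite (le_trans x0 xs) (le_trans sx x1).
  have t01 t : y <= t <= y + h -> 0 <= t <= 1.
    by move=> /andP[yt ty]; rewrite (le_trans y0 yt) (le_trans ty y1).
  have xle : x <= x + h by rewrite lerDl ltW.
  have yle : y <= y + h by rewrite lerDl ltW.
  have gtN1 (s : R) : 0 <= s <= 1 -> -1 < s.
    by case/andP => s0 _; rewrite (lt_le_trans _ s0) // ltrN10.
  (* A primitive of the affine approximation [F w + D (z - w)]. Its values at the four corners
     cancel in [psi], so only the remainder of the expansion is integrated. *)
  pose G r t := F w * (dilate r t - w) + D * ((dilate r t - w) * (dilate r t - w) / 2).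
  have near_w s t : x <= s <= x + h -> y <= t <= y + h ->
      norm1 (dilate (rho s) t - w) <= 3 * K * h.
    move=> hs ht; apply: lip; [exact: s01|exact: t01|exact: hp|exact: hq| |].
      by apply: (dist_itv hs); rewrite xp px.
    by apply: (dist_itv ht); rewrite yq qy.
  have remainder s t (c : R[i]) : x <= s <= x + h -> y <= t <= y + h -> norm1 c <= K ->
      norm1 (F (dilate (rho s) t) * c - (F w + D * (dilate (rho s) t - w)) * c)
        <= e' * (3 * K * h) * K.
    move=> hs ht hc; rewrite -mulrBl; apply: le_trans (norm1M _ _) _.
    apply: ler_pM => //; try exact: norm1_ge0.
    have nw := near_w s t hs ht.
    rewrite opprD addrA; apply: le_trans (hd _ (le_lt_trans nw hd3)) _.
    by rewrite ler_pM2l.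
  have dG (P : R -> R[i]) u dP : cderiv P u dP ->
      cderiv (fun u => F w * (P u - w) + D * ((P u - w) * (P u - w) / 2)) u
        ((F w + D * (P u - w)) * dP).
    move=> hP; have hPw := cderivB hP (cderiv_cst w u).
    apply: cderivE (cderivD (cderivMl _ hPw)
      (cderivMl D (cderivM (cderivM hPw hPw) (cderiv_cst 2^-1 u)))) _.
    by rewrite subr0 mulr0 add0r; field.
  have sideA s : x <= s <= x + h -> norm1 ((A s (y + h) - G (rho s) (y + h)) -
      (A s y - G (rho s) y)) <= 2 * (e' * (3 * K * h) * K * h).
    move=> hs; have scl : cl s = s by apply: clamp_id; exact: s01.
    have -> : h = y + h - y by ring.
    have yh : y + (y + h - y) = y + h by ring.
    rewrite yh; apply: (@cincrement_bound R (fun t =>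
        F (dilate (rho (cl s)) t) * ((rho (cl s))%:C * g' t)
        - (F w + D * (dilate (rho (cl s)) t - w)) * ((rho (cl s))%:C * g' t))
        (fun t => A s t - G (rho s) t)); first exact: yle.
      move=> t ht; apply: cderivB; first by apply: hA; apply: gtN1; exact: t01.
      by rewrite scl; apply: dG; exact: cderiv_dilate.
    move=> t ht; rewrite scl (_ : y + h - y = h); last by ring.
    apply: remainder => //.
    rewrite norm1Cl -[K]mul1r; apply: ler_pM => //; try exact: norm1_ge0.
      have /rho01/andP[? ?] := s01 s hs.
      by rewrite ger0_norm.
    by apply: bg'; exact: t01.
  have sideB t : y <= t <= y + h -> norm1 ((B t (x + h) - G (rho (x + h)) t) -
      (B t x - G (rho x) t)) <= 2 * (e' * (3 * K * h) * K * h).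
    move=> ht; have -> : h = x + h - x by ring.
    have xh : x + (x + h - x) = x + h by ring.
    rewrite xh; apply: (@cincrement_bound R (fun s =>
        F (dilate (rho (cl s)) t) * (L%:C * (g t - z0))
        - (F w + D * (dilate (rho s) t - w)) * (L%:C * (g t - z0)))
        (fun s => B t s - G (rho s) t)); first exact: xle.
      move=> s hs; apply: cderivB; first by apply: hB; apply: gtN1; exact: s01.
      by apply: (dG (fun s => dilate (rho s) t)); exact: cderiv_dilate_radius.
    move=> s hs; have scl : cl s = s by apply: clamp_id; exact: s01.
    rewrite scl (_ : x + h - x = h); last by ring.
    apply: remainder => //.
    rewrite norm1Cl -[K]mul1r; apply: ler_pM => //; try exact: norm1_ge0.
      by case/andP: L01 => *; rewrite ger0_norm.
    by apply: bg; exact: t01.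
  have -> : psi x y h =
      ((A (x + h) (y + h) - G (rho (x + h)) (y + h)) -
        (A (x + h) y - G (rho (x + h)) y))
      - ((A x (y + h) - G (rho x) (y + h)) - (A x y - G (rho x) y))
      - ((B (y + h) (x + h) - G (rho (x + h)) (y + h)) -
        (B (y + h) x - G (rho x) (y + h)))
      + ((B y (x + h) - G (rho (x + h)) y) - (B y x - G (rho x) y)).
    by rewrite /psi; ring.
  have xx : x <= x <= x + h by rewrite lexx lerDl ltW.
  have xh : x <= x + h <= x + h by rewrite lexx lerDl ltW.
  have yy : y <= y <= y + h by rewrite lexx lerDl ltW.
  have yh : y <= y + h <= y + h by rewrite lexx lerDl ltW.
  apply: le_trans (norm1D _ _) _; apply: le_trans (lerD (norm1D _ _) (sideB _ yy)) _.
  rewrite norm1N; apply: le_trans (lerD (lerD (norm1D _ _) (sideB _ yh)) (lexx _)) _.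
  rewrite norm1N; apply: le_trans (lerD (lerD (lerD (sideA _ xh) (sideA _ xx)) (lexx _)) (lexx _)) _.
  rewrite le_eqVlt; apply/orP; left; apply/eqP; rewrite /e'.
  by field; exact: lt0r_neq0.
have psi0 : psi 0 0 1 = 0.
  apply/eqP; rewrite -norm1_eq0 eq_le norm1_ge0 andbT; apply/ler_addgt0Pr => e /psi_le.
  by rewrite !mulr1 add0r.
have cl0 : cl 0 = 0 by apply: clamp_id; rewrite lexx ler01.
have cl1 : cl 1 = 1 by apply: clamp_id; rewrite lexx ler01.
have EA x : A x 1 - A x 0 = cintegral (fun t =>
    F (dilate (rho (cl x)) t) * ((rho (cl x))%:C * g' t)).
  by rewrite (cintegral_primitive (cA x) (hA x)).
have EB y : B y 1 - B y 0 = cintegral (fun s =>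
    F (dilate (rho (cl s)) y) * (L%:C * (g y - z0))).
  by rewrite (cintegral_primitive (cB y) (hB y)).
have rho_1 : rho 1 = r2 by rewrite /rho /L; ring.
have rho_0 : rho 0 = r1 by rewrite /rho; ring.
(* As the curve is closed, the two radial sides coincide and cancel. The other two sides are the
   integrals to be compared. *)
have dil s : dilate s 1 = dilate s 0 by rewrite /dilate g01.
move: psi0; rewrite /psi !add0r !EA !EB cl0 cl1 rho_1 rho_0 -g01.
under [X in _ - (X - _) = _]eq_cintegral do rewrite dil.
by rewrite subrr subr0 => /eqP; rewrite subr_eq0 => /eqP ->.
Qed.

End Homotopy.

(** * Cauchy's formula up to the boundary *)

Lemma gt0_real_neq0 (R : realType) (r : R) : 0 < r -> r%:C != 0 :> R[i].
Proof. by move=> r0; rewrite -ltcR in r0; exact: lt0r_neq0. Qed.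

Section Paths.
Variable R : realType.
Implicit Types (gamma : R -> R[i]^o).

Lemma smooth_C1 (h : R -> R) : smooth_fun h -> C1_fun h.
Proof.
move=> sh; split; first exact: (sh 0%N).
move=> t; apply: differentiable_continuous; apply/derivable1_diffP.
exact: (sh 1%N).
Qed.

Lemma C1_cderiv gamma : C1_fun (re_path gamma) -> C1_fun (im_path gamma) ->
  (forall t, cderiv gamma t (path_deriv gamma t)) /\ ccont (path_deriv gamma).
Proof.
move=> [h1 h2] [k1 k2]; split; last exact: conj h2 k2.
by move=> t; split; apply: DeriveDef; [exact: h1|by rewrite -derive1E|exact: k1|by rewrite -derive1E].
Qed.

Lemma cderiv_C1 gamma D : (forall t, cderiv gamma t (D t)) -> ccont D ->
  [/\ C1_fun (re_path gamma), C1_fun (im_path gamma) & path_deriv gamma = D].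
Proof.
move=> h [D1 D2].
have e1 : derive1 (re_path gamma) = fun t => re (D t).
  by apply/funext => t; rewrite derive1E; case: (h t) => h1 _; rewrite derive_val.
have e2 : derive1 (im_path gamma) = fun t => im (D t).
  by apply/funext => t; rewrite derive1E; case: (h t) => _ h1; rewrite derive_val.
split.
- by split; [move=> t; case: (h t) => -[] | rewrite e1].
- by split; [move=> t; case: (h t) => _ [] | rewrite e2].
- by apply/funext => t; rewrite /path_deriv e1 e2; case: (D t).
Qed.

Lemma inv_2pii_neq0 : inv_2pii R != 0.
Proof.
rewrite invr_eq0; apply/eqP => /(congr1 im) /= /eqP.
by rewrite mulf_eq0 pnatr_eq0 /= gt_eqF // pi_gt0.
Qed.

Lemma contour_intE gamma (f : R[i]^o -> R[i]^o) :
  contour_int gamma f = cintegral (fun t => f (gamma t) * path_deriv gamma t).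
Proof. by []. Qed.

End Paths.

Section Boundary.
Variable R : realType.
Variables (Omega : set R[i]^o) (gamma : R -> R[i]^o).
Hypothesis Omega_open : open Omega.
Hypothesis Omega_convex : convex_set Omega.
Hypothesis Omega_boundary : smooth_boundary Omega gamma.

Let boundary_C1 : (forall t, cderiv gamma t (path_deriv gamma t)) /\ ccont (path_deriv gamma).
Proof.
apply: C1_cderiv; apply: smooth_C1.
  exact: sb_smooth_re Omega_boundary.
exact: sb_smooth_im Omega_boundary.
Qed.

Lemma boundary_cderiv t : cderiv gamma t (path_deriv gamma t).
Proof. exact: boundary_C1.1. Qed.

Lemma boundary_deriv_ccont : ccont (path_deriv gamma).
Proof. exact: boundary_C1.2. Qed.

Lemma boundary_ccont : ccont gamma.
Proof. exact: cderiv_ccont boundary_cderiv. Qed.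

Lemma boundary_closed : gamma 0 = gamma 1.
Proof. by rewrite -[1]add0r (sb_periodic Omega_boundary). Qed.

Lemma boundary_bdry t : bdry Omega (gamma t).
Proof. by rewrite -(sb_range Omega_boundary); exists t. Qed.

Lemma boundary_closure t : closure Omega (gamma t).
Proof. by case: (boundary_bdry t). Qed.

Lemma boundary_notin t : ~ Omega (gamma t).
Proof. by case: (boundary_bdry t) => _; rewrite (interior_id _).1. Qed.

Lemma boundary_subr_neq0 t z : Omega z -> gamma t - z != 0.
Proof.
by move=> Oz; rewrite subr_eq0; apply/eqP => e; apply: (@boundary_notin t); rewrite e.
Qed.

Lemma ccont_boundary_inv z : Omega z -> ccont (fun t => (gamma t - z)^-1).
Proof.
move=> Oz; apply: ccontV; first by move=> t; exact: boundary_subr_neq0.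
by apply: ccontB; [exact: boundary_ccont|exact: ccont_cst].
Qed.

Lemma dilate_inside z0 r t : Omega z0 -> 0 <= r < 1 -> Omega (dilate gamma z0 r t).
Proof. by move=> Oz0 hr; apply: segment_interior => //; exact: boundary_closure. Qed.

Lemma cdiff_subV z w : w != z -> exists D, cdiff (fun u : R[i] => (u - z)^-1) w D.
Proof.
move=> wz; apply: derivable_cdiff.
apply: (@derivableV R[i] R[i]^o (fun u => u - z)); first by rewrite subr_eq0.
by apply: derivableB; [exact: derivable_id|exact: derivable_cst].
Qed.

(** The contraction stays in Omega and so never meets [z]; at radius 0 the integrand vanishes. *)
Lemma dilate_index_outside z0 r z : Omega z0 -> 0 <= r < 1 -> ~ Omega z ->
  cintegral (fun t => (dilate gamma z0 r t - z)^-1 * (r%:C * path_deriv gamma t)) = 0.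
Proof.
move=> Oz0 /andP[r0 r1] Oz.
have := @homotopy_invariance R gamma _ z0 boundary_cderiv boundary_deriv_ccont
  boundary_closed (fun u => (u - z)^-1) 0 r (lexx 0) r0 (ltW r1).
move=> <-.
  by rewrite -[RHS]cintegral_cst; apply: eq_cintegral => t _; rewrite !mul0r mulr0.
move=> s t /andP[s0 sr]; apply: cdiff_subV; apply/eqP => e; apply: Oz; rewrite -e.
by apply: dilate_inside => //; rewrite s0 (le_lt_trans sr).
Qed.

Lemma A_alg_ccont f : A_alg Omega f -> ccont (fun t => f (gamma t)).
Proof.
move=> [_ cf _]; apply/ccontP => t e e0.
have [d d0 hd] := within_ccont cf (@boundary_closure t) e0.
have [d' d'0 hd'] := (ccontP _).1 boundary_ccont t d d0.
by exists d' => // s hs; apply: hd; [exact: boundary_closure|exact: hd'].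
Qed.

(** This carries integrals over dilated curves to the boundary. Continuity of [f] on the closure
    gives the bound near each boundary point, and bisection makes the radius uniform in [t]. *)
Lemma dilate_uniform f z0 (e : R) : A_alg Omega f -> Omega z0 -> 0 < e ->
  exists2 d, 0 < d & forall t r, 0 <= t <= 1 -> 1 - d < r < 1 -> 0 <= r ->
    norm1 (f (dilate gamma z0 r t) - f (gamma t)) <= e.
Proof.
move=> [_ cf _] Oz0 e0.
apply: (@interval_bisection R (fun a b => exists2 d, 0 < d & forall t r, a <= t <= b ->
  1 - d < r < 1 -> 0 <= r -> norm1 (f (dilate gamma z0 r t) - f (gamma t)) <= e)).
  move=> a b c ab bc [d d0 hd] [d' d'0 hd']; exists (Num.min d d'); first by rewrite lt_min d0.
  move=> t r /andP[ta tc]; rewrite ltrBlDl -ltrBlDr lt_min => /andP[/andP[h1 h2] r1] r0.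
  have [tb|/ltW tb] := leP t b; [apply: hd|apply: hd'] => //; rewrite ?ta ?tb //;
    apply/andP; split; lra.
move=> p hp.
have e2 : 0 < e / 2 by lra.
have [d d0 hd] := within_ccont cf (@boundary_closure p) e2.
have [K K0 hK] := ccont_bounded (ccontB boundary_ccont (ccont_cst z0)).
have d2 : 0 < d / 2 by lra.
have [d' d'0 hd'] := (ccontP _).1 boundary_ccont p _ d2.
exists d' => // a b /andP[a0 ap] /andP[pb b1] /andP[_ ba].
exists (d / (2 * K)); first by rewrite divr_gt0 // mulr_gt0.
move=> t r /andP[ta tb] /andP[rd r1] r0.
have ht : norm1 (gamma t - gamma p) < d / 2.
  by apply: hd'; rewrite ltr_norml; apply/andP; split; lra.
have h1 : norm1 (f (gamma t) - f (gamma p)) < e / 2.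
  by apply: hd; [exact: boundary_closure|lra].
have h2 : norm1 (f (dilate gamma z0 r t) - f (gamma p)) < e / 2.
  apply: hd.
    by apply: subset_closure; apply: dilate_inside => //; rewrite r0.
  have -> : dilate gamma z0 r t - gamma p =
      (gamma t - gamma p) - (1 - r)%:C * (gamma t - z0).
    by rewrite /dilate rmorphB rmorph1; ring.
  apply: le_lt_trans (norm1D _ _) _; rewrite norm1N norm1Cl ger0_norm ?subr_ge0 ?ltW //.
  have hKt : norm1 (gamma t - z0) <= K by apply: hK; apply/andP; split; lra.
  have : (1 - r) * norm1 (gamma t - z0) < d / 2.
    apply: (@le_lt_trans _ _ ((1 - r) * K)); first by rewrite ler_wpM2l // subr_ge0 ltW.
    rewrite -ltr_pdivlMr // -mulrA -invfM; lra.
  lra.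
apply: le_trans (norm1_tri (f (gamma p)) _ _) _.
rewrite (norm1B (f (gamma p))); lra.
Qed.

(** The integral [J r] of [(f z - f z0) / (z - z0)] over the curve dilated by [r] is constant on
    [0 < r < 1]. Small radii show that the constant is 0, and radii close to 1 transfer this to the
    boundary, where the winding number is 1. *)
Lemma cauchy_formula f z0 : A_alg Omega f -> Omega z0 ->
  inv_2pii R * contour_int gamma (fun zeta => f zeta / (zeta - z0)) = f z0.
Proof.
move=> Af Oz0; have [df _ _] := Af.
(* The form [dz / (z - z0)] pulls back to the same density [k] on every dilated curve, since the
   radius cancels. Hence a single bound [K] serves for all radii. *)
pose k t := path_deriv gamma t * (gamma t - z0)^-1.
have ck : ccont k.
  by apply: ccontM; [exact: boundary_deriv_ccont|exact: ccont_boundary_inv].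
have [K K0 hK] := ccont_bounded ck.
have cfd r : 0 <= r < 1 -> ccont (fun t => f (dilate gamma z0 r t)).
  move=> hr; apply: ccont_cdiff; first exact: ccont_dilate boundary_cderiv _.
  by move=> t; apply: derivable_cdiff; apply: df; exact: dilate_inside.
pose J r := cintegral (fun t => (f (dilate gamma z0 r t) - f z0) * k t).
have J_const r s : 0 < r -> r <= s -> s < 1 -> J r = J s.
  move=> r0 rs s1; pose F u := (f u - f z0) * (u - z0)^-1.
  have := @homotopy_invariance R gamma _ z0 boundary_cderiv boundary_deriv_ccont
    boundary_closed F r s (ltW r0) rs (ltW s1).
  have JE q : 0 < q -> q < 1 -> J q = cintegral (fun t => F (dilate gamma z0 q t) *
      (q%:C * path_deriv gamma t)).
    move=> q0 q1; apply: eq_cintegral => t _; rewrite /F /k /dilate.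
    rewrite [z0 + _ - z0]addrC addKr invfM; have := boundary_subr_neq0 t Oz0.
    have : q%:C != 0 by exact: gt0_real_neq0.
    by move=> n0 n1; field; apply/andP.
  rewrite -!JE //; [|exact: lt_le_trans rs|exact: le_lt_trans s1]; apply.
  move=> q t /andP[rq qs].
  have q01 : 0 <= q < 1 by apply/andP; split; lra.
  apply: derivable_cdiff.
  apply: (@derivableM R[i] R[i]^o (fun u => f u - f z0) (fun u => (u - z0)^-1)).
    by apply: derivableB; [apply: df; exact: dilate_inside|exact: derivable_cst].
  apply: (@derivableV R[i] R[i]^o (fun u => u - z0)).
    rewrite /dilate [z0 + _ - z0]addrC addKr mulf_neq0 ?boundary_subr_neq0 //.
    by apply: gt0_real_neq0; lra.
  by apply: derivableB; [exact: derivable_id|exact: derivable_cst].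
have J_small (h : R -> R[i]) e : ccont h -> (forall t, 0 <= t <= 1 -> norm1 (h t) <= e) ->
    norm1 (cintegral (fun t => h t * k t)) <= 2 * (e * K).
  move=> ch he; apply: cintegral_bound; first exact: ccontM.
  move=> t ht; apply: le_trans (norm1M _ _) _.
  by apply: ler_pM; rewrite ?norm1_ge0 ?he ?hK.
have J0 r : 0 < r -> r < 1 -> J r = 0.
  move=> r0 r1; apply/eqP; rewrite -norm1_eq0 eq_le norm1_ge0 andbT.
  apply/ler_addgt0Pr => e e0; rewrite add0r.
  have eK : 0 < e / (2 * K) by rewrite divr_gt0 // mulr_gt0.
  have [D hD] := derivable_cdiff (df z0 Oz0).
  have [d d0 hd] := cdiff_continuous hD eK.
  have [B B0 hB] := ccont_bounded (ccontB boundary_ccont (ccont_cst z0)).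
  (* A radius for which the whole dilated curve lies within [d] of [z0]; [B] bounds [gamma - z0]. *)
  pose q := Num.min r (d / (2 * B)).
  have q0 : 0 < q by rewrite lt_min r0 divr_gt0 // mulr_gt0.
  have qr : q <= r by rewrite ge_min lexx.
  have qd : q * (2 * B) <= d by rewrite -ler_pdivlMr ?mulr_gt0 // ge_min lexx orbT.
  rewrite -(J_const q r) //.
  have -> : e = 2 * (e / (2 * K) * K) by field; exact: lt0r_neq0.
  apply: J_small.
    by apply: ccontB; [apply: cfd; apply/andP; split; lra|exact: ccont_cst].
  move=> t ht; apply/ltW/hd.
  rewrite /dilate [z0 + _ - z0]addrC addKr norm1Cl gtr0_norm //.
  apply: (@le_lt_trans _ _ (q * B)); first by rewrite ler_pM2l // hB.
  have := mulr_gt0 q0 B0; lra.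
have J1 : cintegral (fun t => (f (gamma t) - f z0) * k t) = 0.
  apply/eqP; rewrite -norm1_eq0 eq_le norm1_ge0 andbT.
  apply/ler_addgt0Pr => e e0; rewrite add0r.
  have eK : 0 < e / (2 * K) by rewrite divr_gt0 // mulr_gt0.
  have [d d0 hd] := dilate_uniform Af Oz0 eK.
  pose r := Num.max (1 / 2) (1 - d / 2).
  have r0 : 1 / 2 <= r by rewrite le_max lexx.
  have r1 : r < 1 by rewrite gt_max; apply/andP; split; lra.
  have rd : 1 - d < r by rewrite lt_max; apply/orP; right; lra.
  have r0' : 0 <= r by lra.
  rewrite -[X in norm1 X]subr0 -(J0 r) //; last by lra.
  rewrite norm1B /J -cintegralB; last 2 first.
  - by apply: ccontM => //; apply: ccontB; [apply: cfd; rewrite r0'|exact: ccont_cst].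
  - by apply: ccontM => //; apply: ccontB; [exact: A_alg_ccont|exact: ccont_cst].
  have -> : e = 2 * (e / (2 * K) * K) by field; exact: lt0r_neq0.
  under eq_cintegral do rewrite -mulrBl opprB addrA subrK.
  apply: J_small.
    by apply: ccontB; [apply: cfd; rewrite r0'|exact: A_alg_ccont].
  by move=> t ht; apply: hd => //; rewrite rd.
have := sb_positive Omega_boundary Oz0; rewrite /winding !contour_intE => w1.
have E : cintegral (fun t => f (gamma t) / (gamma t - z0) * path_deriv gamma t) =
    f z0 * cintegral (fun t => (gamma t - z0)^-1 * path_deriv gamma t).
  apply/eqP; rewrite -subr_eq0 -cintegralMl; last first.
    by apply: ccontM; [exact: ccont_boundary_inv|exact: boundary_deriv_ccont].
  rewrite -cintegralB; last 2 first.
  - apply: ccontM; last exact: boundary_deriv_ccont.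
    by apply: ccontM; [exact: A_alg_ccont|exact: ccont_boundary_inv].
  - apply: ccontM; first exact: ccont_cst.
    by apply: ccontM; [exact: ccont_boundary_inv|exact: boundary_deriv_ccont].
  by rewrite -J1; apply/eqP/eq_cintegral => t _; rewrite /k; ring.
by rewrite E mulrCA w1 mulr1.
Qed.

(** A finite part of the open set Omega remains inside when Omega is shrunk slightly towards [z0].
    Applied to the eigenvalues of [T], it provides a contour. *)
Lemma exists_dilation z0 (s : seq R[i]) : Omega z0 -> (forall z, z \in s -> Omega z) ->
  exists2 r0 : R, r0 < 1 & forall r, r0 < r < 1 -> 0 < r -> forall z, z \in s ->
    exists2 w, Omega w & z = z0 + r%:C * (w - z0).
Proof.
move=> Oz0; elim: s => [|z s IH] hs; first by exists 0; rewrite ?ltr01.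
have [r0 r01 hr0] := IH ltac:(by move=> w ws; apply: hs; rewrite inE ws orbT).
have Oz : Omega z by apply: hs; rewrite inE eqxx.
have [d d0 hd] := open_norm1 Omega_open Oz.
pose K := norm1 (z - z0) + 1; have K0 : 0 < K by rewrite ltr_wpDl ?norm1_ge0.
have Kd : 0 < K + d by exact: addr_gt0.
(* Undoing the dilation moves [z] by [(r^-1 - 1) (z - z0)], which is shorter than [d] as soon as
   [r > K / (K + d)]. *)
exists (Num.max r0 (K / (K + d))).
  by rewrite gt_max r01 /= ltr_pdivrMr // mul1r ltrDl.
move=> r; rewrite gt_max => /andP[/andP[h1 h2] r1] rp w; rewrite inE => /orP[/eqP ->|ws].
  have rn0 : r%:C != 0 by exact: gt0_real_neq0.
  exists (z0 + r%:C^-1 * (z - z0)); last by field.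
  apply: hd.
  have -> : z0 + r%:C^-1 * (z - z0) - z = (r^-1 - 1)%:C * (z - z0).
    by rewrite rmorphB rmorph1 fmorphV /=; ring.
  rewrite ltr_pdivrMr // in h2.
  have ir : 1 <= r^-1 by rewrite invf_ge1 // ltW.
  rewrite norm1Cl ger0_norm ?subr_ge0 //.
  apply: (@le_lt_trans _ _ ((r^-1 - 1) * K)).
    by rewrite ler_wpM2l ?subr_ge0 // lerDl ler01.
  rewrite -(ltr_pM2l rp) mulrA mulrBr mulfV ?gt_eqF // mulr1; lra.
by apply: hr0 => //; rewrite h1.
Qed.

(** Scaling preserves winding numbers: the dilated curve turns around [z0 + r (w - z0)] as [gamma]
    turns around [w]. *)
Lemma dilate_surrounds z0 (S : set R[i]^o) r : Omega z0 -> 0 < r < 1 ->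
  (forall z, S z -> exists2 w, Omega w & z = z0 + r%:C * (w - z0)) ->
  surrounds Omega S (dilate gamma z0 r).
Proof.
move=> Oz0 /andP[r0 r1] hS.
have rn0 : r%:C != 0 by exact: gt0_real_neq0.
have cD : ccont (fun t => r%:C * path_deriv gamma t).
  by apply: ccontM; [exact: ccont_cst|exact: boundary_deriv_ccont].
have [c1 c2 pD] := @cderiv_C1 R (dilate gamma z0 r) _
  (fun t => cderiv_dilate z0 boundary_cderiv r t) cD.
split => //.
- by rewrite /dilate boundary_closed.
- move=> t _; split; first by apply: dilate_inside => //; rewrite ltW.
  move=> /hS[w Ow] /eqP; rewrite /dilate (inj_eq (addrI z0)) (inj_eq (mulfI rn0)).
  by rewrite (inj_eq (addIr _)) => /eqP e; apply: (@boundary_notin t); rewrite e.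
- move=> z /hS[w Ow ->]; rewrite -(sb_positive Omega_boundary Ow) /winding.
  apply: (congr1 (fun x => inv_2pii R * x)).
  rewrite !contour_intE pD; apply: eq_cintegral => t _.
  have -> : dilate gamma z0 r t - (z0 + r%:C * (w - z0)) = r%:C * (gamma t - w).
    by rewrite /dilate; ring.
  have n0 := boundary_subr_neq0 t Ow.
  by field; rewrite rn0 n0.
- move=> z Oz; rewrite /winding contour_intE pD dilate_index_outside ?mulr0 //.
  by rewrite ltW.
Qed.

End Boundary.

(** * The resolvent along a closed curve *)

Section Index.
Variable R : realType.

(** Unlike [cintegral_primitive], it asks for the derivative of [F] on [0, 1] only, as is the case
    for a clamped integrand: the difference of [F] and a global primitive has derivative 0 there. *)
Lemma cintegral_FTC (f F : R -> R[i]) : ccont f ->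
  (forall t, 0 <= t <= 1 -> cderiv F t (f t)) -> cintegral f = F 1 - F 0.
Proof.
move=> cf hF; have [G hG] := exists_cprimitive cf.
rewrite (cintegral_primitive cf hG); apply/eqP; rewrite -subr_eq0 -norm1_eq0.
rewrite eq_le norm1_ge0 andbT.
have := @cincrement_bound R (fun t => f t - f t) (fun t => G t - F t) 0 1 0 ler01.
rewrite mul0r mulr0 => h; rewrite [X in norm1 X](_ : _ = G 1 - F 1 - (G 0 - F 0)); last by ring.
apply: h => t ht; last by rewrite subrr norm10.
by apply: cderivB; [apply: hG; case/andP: ht; lra|exact: hF].
Qed.

(* [c] is a closed curve with velocity [c'] and, up to the normalization [w],
   index one around each point of [S]; powers of [c - a] below -1 have a
   primitive, hence the last hypothesis. *)
Variables (c c' : R -> R[i]) (S : R[i] -> Prop) (w : R[i]).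
Hypothesis cc : ccont c.
Hypothesis cc' : ccont c'.
Hypothesis c_avoids : forall a t, S a -> c t - a != 0.
Hypothesis c_index : forall a, S a -> cintegral (fun t => (c t - a)^-1 * c' t) = w.
Hypothesis c_power : forall a k, S a ->
  cintegral (fun t => (c t - a)^-1 ^+ k.+2 * c' t) = 0.

Definition poles (s : seq R[i]) (z : R[i]) : R[i] := \prod_(a <- s) (z - a)^-1.

Lemma ccont_poles s : (forall a, a \in s -> S a) -> ccont (fun t => poles s (c t)).
Proof.
elim: s => [|a s IH] hs; first by under eq_fun do rewrite /poles big_nil; exact: ccont_cst.
under eq_fun do rewrite /poles big_cons.
apply: ccontM; last by apply: IH => b bs; apply: hs; rewrite inE bs orbT.
apply: ccontV; last by apply: ccontB => //; exact: ccont_cst.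
by move=> t; apply: c_avoids; apply: hs; rewrite inE eqxx.
Qed.

(** If all poles agree, this is [c_index] or [c_power]. If two of them differ, partial fractions
    write the product as a multiple of the difference of two products with one factor fewer. These
    have equal length, hence equal integrals by induction. *)
Lemma integral_poles s : (forall a, a \in s -> S a) -> (0 < size s)%N ->
  cintegral (fun t => poles s (c t) * c' t) = if size s == 1%N then w else 0.
Proof.
have [m] := ubnP (size s); elim: m s => // m IH [//|a [|b s]] sm hs _.
  rewrite /= -(c_index (hs a (mem_head _ _))); apply: eq_cintegral => t _.
  by rewrite /poles big_seq1.
rewrite /=; have [/allP aeq|] := boolP (all (pred1 a) (b :: s)).
  rewrite -(c_power (size s) (hs a (mem_head _ _))); apply: eq_cintegral => t _.
  congr (_ * _); rewrite /poles big_cons exprS; congr (_ * _).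
  rewrite (eq_big_seq (fun=> (c t - a)^-1)); last by move=> x /aeq /= /eqP ->.
  by rewrite big_const_seq count_predT iter_mulr_1.
rewrite -has_predC => /hasP[d ds /= da].
have /perm_consP := perm_to_rem ds.
pose s' := rem d (b :: s).
have ss' : size s' = size s by rewrite /s' size_rem.
have sub x : x \in s' -> S x.
  by move=> /mem_rem xs; apply: hs; rewrite inE xs orbT.
have Sa : S a by apply: hs; exact: mem_head.
have Sd : S d by apply: hs; rewrite inE ds orbT.
have subx x y : S x -> y \in x :: s' -> S y.
  by move=> Sx; rewrite inE => /orP[/eqP ->|/sub].
move=> _.
have ad : a - d != 0 by rewrite subr_eq0 eq_sym.
have cx x : S x -> ccont (fun t => poles (x :: s') (c t) * c' t).
  by move=> Sx; apply: ccontM => //; apply: ccont_poles => y; exact: subx.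
have -> : cintegral (fun t => poles [:: a, b & s] (c t) * c' t) =
    (a - d)^-1 * (cintegral (fun t => poles (a :: s') (c t) * c' t) -
                  cintegral (fun t => poles (d :: s') (c t) * c' t)).
  rewrite -cintegralB; [|exact: cx|exact: cx].
  rewrite -cintegralMl; last by apply: ccontB; exact: cx.
  apply: eq_cintegral => t _.
  rewrite /poles [in LHS]big_cons [in LHS](perm_big _ (perm_to_rem ds)) /= !big_cons.
  have na := c_avoids t Sa; have nd := c_avoids t Sd.
  by rewrite -/s'; field; rewrite ad na nd.
rewrite !IH /= ?ss' ?subrr ?mulr0 //; first by move=> x; exact: subx.
by move=> x; exact: subx.
Qed.

Section Resolvent.
Variables (n : nat) (T : 'M[R[i]]_n.+1).

(* Newton's form of (z - T)^-1: it terminates by Cayley-Hamilton when [s] lists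
   the eigenvalues of T with multiplicity. *)
Fixpoint newton_resolvent (s : seq R[i]) (z : R[i]) : 'M[R[i]]_n.+1 :=
  if s is a :: s' then
    (z - a)^-1 *: (1%:M + (T - a%:M) *m newton_resolvent s' z)
  else 0.

Lemma newton_resolvent_cons a s z i j : newton_resolvent (a :: s) z i j =
  (z - a)^-1 * ((i == j)%:R + \sum_k (T - a%:M) i k * newton_resolvent s z k j).
Proof. by rewrite /= mxE mxE mxE; congr (_ * (_ + _)); rewrite mxE. Qed.

Lemma newton_resolventP s z : (forall a, a \in s -> z != a) ->
  (z%:M - T) *m newton_resolvent s z =
  1%:M - poles s z *: \prod_(a <- s) (T - a%:M).
Proof.
elim: s => [|a s IH] hs.
  by rewrite /poles !big_nil mulmx0 scale1r subrr.
have za : z - a != 0 by rewrite subr_eq0; apply: hs; exact: mem_head.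
rewrite /= -scalemxAr mulmxDr mulmx1.
have -> : (z%:M - T) *m ((T - a%:M) *m newton_resolvent s z) =
    (T - a%:M) *m ((z%:M - T) *m newton_resolvent s z).
  rewrite !mulmxA; congr (_ *m _).
  rewrite !(mulmxBl, mulmxBr) !(mul_scalar_mx, mul_mx_scalar) !scale_scalar_mx.
  rewrite [a * z]mulrC !opprB addrACA [RHS]addrACA; congr (_ + _); exact: addrC.
rewrite IH; last by move=> b bs; apply: hs; rewrite inE bs orbT.
rewrite /poles !big_cons mulmxBr mulmx1 addrA subrKA.
rewrite (_ : z%:M - a%:M = (z - a)%:M); last by rewrite raddfB.
rewrite scalerBr scale_scalar_mx mulVf // -scalemxAr scalerA; congr (_ - _ *: _).
Qed.

Lemma exists_eigenvalues : exists s : seq R[i],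
  (forall a, a \in s = eigenvalue T a) /\ \prod_(a <- s) (T - a%:M) = 0.
Proof.
have [s hs] := closed_field_poly_normal (char_poly T).
rewrite (monicP (char_poly_monic T)) scale1r in hs.
exists s; split => [a|].
  by rewrite eigenvalue_root_char hs root_prod_XsubC.
have := Cayley_Hamilton T; rewrite hs rmorph_prod /= => <-.
apply: eq_bigr => a _; rewrite rmorphB /= horner_mx_X horner_mx_C //.
Qed.

Lemma newton_resolventE s z : \prod_(a <- s) (T - a%:M) = 0 ->
  (forall a, a \in s -> z != a) ->
  z%:M - T \in unitmx /\ invmx (z%:M - T) = newton_resolvent s z.
Proof.
move=> s0 hs; have := newton_resolventP hs; rewrite s0 scaler0 subr0 => h.
have [u _] := mulmx1_unit h; split => //.
by rewrite -[RHS](mulKmx u) h mulmx1.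
Qed.

Lemma ccont_newton s i j : (forall a, a \in s -> S a) ->
  ccont (fun t => newton_resolvent s (c t) i j).
Proof.
elim: s i j => [|a s IH] i j hs; first by under eq_fun do rewrite /= mxE; exact: ccont_cst.
under eq_fun do rewrite newton_resolvent_cons.
apply: ccontM.
  apply: ccontV; last by apply: ccontB => //; exact: ccont_cst.
  by move=> t; apply: c_avoids; apply: hs; exact: mem_head.
apply: ccontD; first exact: ccont_cst.
apply: ccont_sum => k _; apply: ccontM; first exact: ccont_cst.
by apply: IH => b bs; apply: hs; rewrite inE bs orbT.
Qed.

(** [pre] accumulates the poles met while Newton's form is unfolded. Only the leading term has a
    single pole; all deeper terms have at least two and integrate to 0. *)
Lemma integral_newton pre s i j : (forall a, a \in pre -> S a) ->
  (forall a, a \in s -> S a) -> (0 < size s)%N || (0 < size pre)%N ->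
  cintegral (fun t => poles pre (c t) * newton_resolvent s (c t) i j * c' t) =
  if size pre == 0%N then (i == j)%:R * w else 0.
Proof.
elim: s pre i j => [|a s IH] pre i j hpre hs /= ne.
  rewrite lt0n in ne; rewrite (negbTE ne) -[RHS]cintegral_cst.
  by apply: eq_cintegral => t _; rewrite mxE mulr0 mul0r.
have Sa : S a by apply: hs; exact: mem_head.
have hs' b : b \in s -> S b by move=> bs; apply: hs; rewrite inE bs orbT.
have hpre' b : b \in a :: pre -> S b by rewrite inE => /orP[/eqP ->|/hpre].
have E t : poles pre (c t) * newton_resolvent (a :: s) (c t) i j * c' t =
    (i == j)%:R * (poles (a :: pre) (c t) * c' t) +
    \sum_k (T - a%:M) i k *
      (poles (a :: pre) (c t) * newton_resolvent s (c t) k j * c' t).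
  rewrite newton_resolvent_cons /poles big_cons.
  set P := \prod_(_ <- _) _; rewrite !(mulrDr, mulrDl); congr (_ + _); first by ring.
  by rewrite !(mulr_sumr, mulr_suml); apply: eq_bigr => k _; ring.
under eq_cintegral do rewrite E.
have cpoles : ccont (fun t => poles (a :: pre) (c t) * c' t).
  by apply: ccontM => //; exact: ccont_poles.
have cN k : ccont (fun t => poles (a :: pre) (c t) * newton_resolvent s (c t) k j * c' t).
  by apply: ccontM => //; apply: ccontM; [exact: ccont_poles|exact: ccont_newton].
rewrite cintegralD; last 2 first.
- by apply: ccontM => //; exact: ccont_cst.
- by apply: ccont_sum => k _; apply: ccontM; [exact: ccont_cst|exact: cN].
rewrite cintegral_sum; last by move=> k _; apply: ccontM; [exact: ccont_cst|exact: cN].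
rewrite big1 ?addr0; last first.
  by move=> k _; rewrite cintegralMl // IH //= ?orbT // mulr0.
rewrite cintegralMl // integral_poles //= eqSS.
by case: ifP => // _; rewrite mulr0.
Qed.

Hypothesis S_eigen : forall a, eigenvalue T a -> S a.

Lemma resolvent_unit t : (c t)%:M - T \in unitmx.
Proof.
have [s [hs s0]] := exists_eigenvalues.
have ne a : a \in s -> c t != a.
  by rewrite hs => /S_eigen Sa; rewrite -subr_eq0; exact: c_avoids.
by case: (newton_resolventE s0 ne).
Qed.

Lemma invmx_resolventE s : (forall a, a \in s = eigenvalue T a) ->
  \prod_(a <- s) (T - a%:M) = 0 ->
  forall t, invmx ((c t)%:M - T) = newton_resolvent s (c t).
Proof.
move=> hs s0 t; have ne a : a \in s -> c t != a.
  by rewrite hs => /S_eigen Sa; rewrite -subr_eq0; exact: c_avoids.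
by case: (newton_resolventE s0 ne).
Qed.

Lemma ccont_resolvent i j : ccont (fun t => invmx ((c t)%:M - T) i j).
Proof.
have [s [hs s0]] := exists_eigenvalues.
under eq_fun do rewrite (invmx_resolventE hs s0).
by apply: ccont_newton => a; rewrite hs; exact: S_eigen.
Qed.

Lemma integral_resolvent i j :
  cintegral (fun t => invmx ((c t)%:M - T) i j * c' t) = (i == j)%:R * w.
Proof.
have [s [hs s0]] := exists_eigenvalues.
have -> : (i == j)%:R * w = if size (Nil R[i]) == 0%N then (i == j)%:R * w else 0 by [].
rewrite -(@integral_newton [::] s i j) //.
- apply: eq_cintegral => t _; rewrite (invmx_resolventE hs s0) /poles big_nil mul1r //.
- by move=> a; rewrite hs; exact: S_eigen.
- case: s s0 {hs} => //; rewrite big_nil => /eqP; by rewrite oner_eq0.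
Qed.

End Resolvent.
End Index.

(** * Fubini for Cauchy kernels *)

Section FubiniSquare.
Variable R : realType.
Local Notation mu := (@lebesgue_measure R).

(** Joint measurability and the bound give integrability on the square; continuity in each variable
    makes the inner integrals finite, so that [fine] does not alter them. *)
Lemma fubini_square (k : R -> R -> R) (M : R) :
  measurable_fun setT (fun p : R * R => k p.1 p.2) ->
  (forall s, continuous (k s)) -> (forall t, continuous (k ^~ t)) ->
  (forall s t, 0 <= s <= 1 -> 0 <= t <= 1 -> `|k s t| <= M) ->
  \int[mu]_(s in `[0, 1]) (\int[mu]_(t in `[0, 1]) k s t) =
  \int[mu]_(t in `[0, 1]) (\int[mu]_(s in `[0, 1]) k s t).
Proof.
move=> mk c1 c2 bk.
pose I : set R := `[0, 1]%classic.
have mI : measurable I by exact: measurable_itv.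
have mD : measurable (I `*` I) by exact: measurableX.
pose K := fun p : R * R => k p.1 p.2.
pose f : R * R -> \bar R := (EFin \o K) \_ (I `*` I).
have fE s t : f (s, t) = ((fun s => ((EFin \o k s) \_ I) t) \_ I) s.
  by rewrite /f !patchE in_setX /=; case: (s \in I).
have intf : (mu \x mu)%E.-integrable setT f.
  rewrite /f; apply/integrable_restrict => //; rewrite setTI.
  apply: measurable_bounded_integrable => //.
  - rewrite [ltLHS]product_measure1E //= lebesgue_measure_itv /= lte_fin ltr01.
    by rewrite -EFinB subr0 mule1 ltry.
  - exact: measurable_funS mk.
  - exists M; split; first exact: num_real.
    move=> x Mx [s t] [/=]; rewrite /I /= !in_itv /= => hs ht.
    by rewrite (le_trans (bk s t hs ht)) // ltW.
have F := Fubini intf.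
have in1 s : (\int[mu]_t f (s, t) =
    ((fun s => (\int[mu]_(t in I) k s t)%:E) \_ I) s)%E.
  under eq_integral do rewrite fE.
  rewrite patchE; case: ifP => hs; last first.
    by under eq_integral do rewrite patchE hs; rewrite integral0.
  under eq_integral do rewrite patchE hs.
  rewrite -integral_mkcond /Rintegral fineK //.
  exact: integrable_fin_num (continuous_integrable (c1 s)).
have in2 t : (\int[mu]_s f (s, t) =
    ((fun t => (\int[mu]_(s in I) k s t)%:E) \_ I) t)%E.
  under eq_integral do rewrite fE.
  rewrite -integral_mkcond patchE; case: ifP => ht; last first.
    by under eq_integral do rewrite patchE ht; rewrite integral0.
  under eq_integral do rewrite patchE ht.
  rewrite /Rintegral fineK //.
  exact: integrable_fin_num (continuous_integrable (c2 t)).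
move: F.
under eq_integral do rewrite in1.
under [X in _ = X -> _]eq_integral do rewrite in2.
by rewrite -!integral_mkcond => F; rewrite /Rintegral; congr fine.
Qed.

Definition cmeas (f : R * R -> R[i]) :=
  measurable_fun setT (fun p => re (f p)) /\ measurable_fun setT (fun p => im (f p)).

Lemma cmeas_fst (u : R -> R[i]) : ccont u -> cmeas (fun p => u p.1).
Proof.
move=> [h1 h2]; split.
  exact: (measurableT_comp (continuous_measurable_fun h1) measurable_fst).
exact: (measurableT_comp (continuous_measurable_fun h2) measurable_fst).
Qed.

Lemma cmeas_snd (u : R -> R[i]) : ccont u -> cmeas (fun p => u p.2).
Proof.
move=> [h1 h2]; split.
  exact: (measurableT_comp (continuous_measurable_fun h1) measurable_snd).
exact: (measurableT_comp (continuous_measurable_fun h2) measurable_snd).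
Qed.

Lemma cmeasM f g : cmeas f -> cmeas g -> cmeas (fun p => f p * g p).
Proof.
move=> [f1 f2] [g1 g2]; split.
  by under eq_fun do rewrite reM; apply: measurable_funB; apply: measurable_funM.
by under eq_fun do rewrite imM; apply: measurable_funD; apply: measurable_funM.
Qed.

Lemma cmeasB f g : cmeas f -> cmeas g -> cmeas (fun p => f p - g p).
Proof.
move=> [f1 f2] [g1 g2]; split.
  by under eq_fun do rewrite reD reN; apply: measurable_funB.
by under eq_fun do rewrite imD imN; apply: measurable_funB.
Qed.

Lemma cmeasV f : (forall p, f p != 0) -> cmeas f -> cmeas (fun p => (f p)^-1).
Proof.
move=> f0 [f1 f2].
have mV : measurable_fun setT (fun p => (re (f p) ^+ 2 + im (f p) ^+ 2)^-1).
  have mpos (h : R * R -> R) : (forall p, 0 < h p) -> measurable_fun setT h ->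
      measurable_fun setT (fun p => (h p)^-1).
    move=> h0 mh.
    (* For a positive function, the inverse becomes a composite of functions known to be
       measurable. *)
    have -> : (fun p => (h p)^-1) = (fun p => expR (- ln (h p))).
      by apply/funext => p; rewrite expRN lnK // posrE.
    apply: measurableT_comp; first exact: measurable_expR.
    apply: measurableT_comp; first exact: oppr_measurable.
    by apply: measurableT_comp => //; exact: measurable_ln.
  apply: mpos => [p|]; first exact: sqr_parts_gt0.
  under eq_fun do rewrite !expr2.
  by apply: measurable_funD; apply: measurable_funM.
split; first by under eq_fun do rewrite reV; apply: measurable_funM.
under eq_fun do rewrite imV.
apply: (@measurableT_comp _ _ _ _ _ _ (-%R : R -> R)); first exact: oppr_measurable.
exact: measurable_funM.
Qed.

(** It amounts to [(|x| + |y|)^2 <= 2 (x^2 + y^2)]. *)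
Lemma norm1_inv (z : R[i]) : z != 0 -> norm1 z^-1 <= 2 / norm1 z.
Proof.
move=> z0; have q0 := sqr_parts_gt0 z0.
have e : norm1 z^-1 = norm1 z / (re z ^+ 2 + im z ^+ 2).
  rewrite /norm1 reV imV normrN !normrM mulrDl.
  by rewrite (ger0_norm (x := (_ + _)^-1)) // invr_ge0 ltW.
rewrite e ler_pdivrMr // mulrAC ler_pdivlMr ?norm1_gt0 //.
rewrite /norm1 -(real_normK (num_real (re z))) -(real_normK (num_real (im z))).
move: (`|re z|) (`|im z|) => x y; have := sqr_ge0 (x - y).
rewrite !expr2; lra.
Qed.

Lemma cauchy_kernel_bounded (a b : R -> R[i]) : ccont a -> ccont b ->
  (forall s t, a t - b s != 0) ->
  exists2 M, 0 < M & forall s t, 0 <= s <= 1 -> 0 <= t <= 1 ->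
    norm1 ((a t - b s)^-1) <= M.
Proof.
move=> /ccontP ca /ccontP cb ne.
suff: exists2 M, 0 < M & forall s t, 0 <= s <= 0 + 1 -> 0 <= t <= 0 + 1 ->
    norm1 ((a t - b s)^-1) <= M by rewrite add0r.
apply: (@square_bisection R (fun x y h => exists2 M, 0 < M & forall s t,
  x <= s <= x + h -> y <= t <= y + h -> norm1 ((a t - b s)^-1) <= M)).
  move=> x y h h0 [M1 M10 h1] [M2 M20 h2] [M3 M30 h3] [M4 M40 h4].
  exists (M1 + M2 + M3 + M4); first by do !apply: addr_gt0.
  move=> s t /andP[xs sx] /andP[yt ty].
  have [sl|sl] := leP s (x + h / 2); have [tl|tl] := leP t (y + h / 2).
  - have := h1 s t; rewrite xs sl yt tl => /(_ isT isT); lra.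
  - have := h3 s t; rewrite xs sl (ltW tl) => /(_ isT).
    have -> : t <= y + h / 2 + h / 2 by lra.
    move=> /(_ isT); lra.
  - have := h2 s t; rewrite (ltW sl) yt tl.
    have -> : s <= x + h / 2 + h / 2 by lra.
    move=> /(_ isT isT); lra.
  - have := h4 s t; rewrite (ltW sl) (ltW tl).
    have -> : s <= x + h / 2 + h / 2 by lra.
    have -> : t <= y + h / 2 + h / 2 by lra.
    move=> /(_ isT isT); lra.
move=> p q hp hq; pose m := norm1 (a q - b p).
have m0 : 0 < m by rewrite norm1_gt0.
have m4 : 0 < m / 4 by lra.
have [d d0 hd] := ca q _ m4; have [d' d'0 hd'] := cb p _ m4.
exists (Num.min d d'); first by rewrite lt_min d0.
move=> x y h /andP[x0 xp] /andP[px x1] /andP[y0 yq] /andP[qy y1] /andP[h0].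
rewrite lt_min => /andP[h1 h2].
(* Near [(p, q)] the difference keeps at least half of its norm [m], and [norm1_inv] costs another
   factor 2. *)
exists (4 / m); first by rewrite divr_gt0.
move=> s t /andP[xs sx] /andP[yt ty].
have ha : norm1 (a t - a q) < m / 4.
  by apply: hd; rewrite ltr_norml; apply/andP; split; lra.
have hb : norm1 (b s - b p) < m / 4.
  by apply: hd'; rewrite ltr_norml; apply/andP; split; lra.
have big : m / 2 <= norm1 (a t - b s).
  have := norm1_tri (a t) (a q) (b p); have := norm1_tri (b s) (a t) (b p).
  rewrite (norm1B (a q) (a t)) -/m; lra.
apply: le_trans (norm1_inv (ne s t)) _.
rewrite ler_pdivrMr ?norm1_gt0 // mulrAC ler_pdivlMr //; lra.
Qed.

Lemma cfubini (u v a b : R -> R[i]) : ccont u -> ccont v -> ccont a -> ccont b ->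
  (forall s t, a t - b s != 0) ->
  cintegral (fun s => cintegral (fun t => u s * v t / (a t - b s))) =
  cintegral (fun t => cintegral (fun s => u s * v t / (a t - b s))).
Proof.
move=> cu cv ca cb ne.
pose k s t := u s * v t / (a t - b s).
have mk : cmeas (fun p => k p.1 p.2).
  apply: cmeasM; first by apply: cmeasM; [exact: cmeas_fst|exact: cmeas_snd].
  apply: cmeasV => //; apply: cmeasB; [exact: cmeas_snd|exact: cmeas_fst].
have c1 s : ccont (k s).
  apply: ccontM; first by apply: ccontM => //; exact: ccont_cst.
  by apply: ccontV => //; apply: ccontB => //; exact: ccont_cst.
have c2 t : ccont (k ^~ t).
  apply: ccontM; first by apply: ccontM => //; exact: ccont_cst.
  by apply: ccontV => //; apply: ccontB => //; exact: ccont_cst.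
have [M M0 hM] := cauchy_kernel_bounded ca cb ne.
have [Ku Ku0 hu] := ccont_bounded cu; have [Kv Kv0 hv] := ccont_bounded cv.
have bk s t : 0 <= s <= 1 -> 0 <= t <= 1 -> norm1 (k s t) <= Ku * Kv * M.
  move=> hs ht; apply: le_trans (norm1M _ _) _; apply: ler_pM; rewrite ?norm1_ge0 ?hM //.
  by apply: le_trans (norm1M _ _) _; apply: ler_pM; rewrite ?norm1_ge0 ?hu ?hv.
apply: complex_ext.
  apply: (@fubini_square (fun s t => re (k s t)) (Ku * Kv * M)).
  - exact: mk.1.
  - by move=> s; exact: (c1 s).1.
  - by move=> t; exact: (c2 t).1.
  - by move=> s t hs ht; apply: le_trans (re_le_norm1 _) _; exact: bk.
apply: (@fubini_square (fun s t => im (k s t)) (Ku * Kv * M)).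
- exact: mk.2.
- by move=> s; exact: (c1 s).2.
- by move=> t; exact: (c2 t).2.
- by move=> s t hs ht; apply: le_trans (im_le_norm1 _) _; exact: bk.
Qed.

End FubiniSquare.

(** * The holomorphic functional calculus as a boundary integral *)

Section ClosedCurve.
Variable R : realType.
Variables (eta : R -> R[i]^o) (S : set R[i]^o).
Hypothesis C1_re : C1_fun (re_path eta).
Hypothesis C1_im : C1_fun (im_path eta).
Hypothesis closed_curve : eta 0 = eta 1.
Hypothesis curve_avoids : forall t, 0 <= t <= 1 -> ~ S (eta t).
Hypothesis curve_index : forall z, S z -> winding eta z = 1.

(** A contour is known to avoid [S] only for parameters in [0, 1]. Curve and velocity are both
    frozen outside, which keeps them continuous and keeps the curve off [S] everywhere without
    changing any integral. *)
Definition clamped (f : R -> R[i]) (t : R) : R[i] := f (clamp 0 1 t).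

Lemma contour_int_clamped (g : R[i]^o -> R[i]^o) : contour_int eta g =
  cintegral (fun t => g (clamped eta t) * clamped (path_deriv eta) t).
Proof. by rewrite contour_intE -[LHS]cintegral_clamp. Qed.

Lemma ccont_clamped_curve : ccont (clamped eta).
Proof.
by apply: (@ccont_clamp R eta); apply: cderiv_ccont; exact: (C1_cderiv C1_re C1_im).1.
Qed.

Lemma ccont_clamped_deriv : ccont (clamped (path_deriv eta)).
Proof. apply: (@ccont_clamp R (path_deriv eta)); exact: (C1_cderiv C1_re C1_im).2. Qed.

Lemma clamp01_itv (t : R) : 0 <= clamp 0 1 t <= 1.
Proof. by apply: clamp_itv; exact: ler01. Qed.

Lemma clamped_avoids a t : S a -> clamped eta t - a != 0.
Proof.
move=> Sa; rewrite subr_eq0; apply/eqP => e.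
by apply: (curve_avoids (clamp01_itv t)); rewrite -[eta _]/(clamped eta t) e.
Qed.

Lemma clamped_index a : S a -> cintegral (fun t =>
  (clamped eta t - a)^-1 * clamped (path_deriv eta) t) = (inv_2pii R)^-1.
Proof.
move=> Sa; apply: (mulfI (inv_2pii_neq0 R)).
by rewrite mulfV ?inv_2pii_neq0 // -(curve_index Sa) /winding contour_int_clamped.
Qed.

Lemma clamped_power a k : S a -> cintegral (fun t =>
  (clamped eta t - a)^-1 ^+ k.+2 * clamped (path_deriv eta) t) = 0.
Proof.
move=> Sa; pose F t : R[i] := - k.+1%:R^-1 * (eta t - a)^-1 ^+ k.+1.
rewrite (@cintegral_FTC R _ F).
- by rewrite /F closed_curve subrr.
- apply: ccontM; last exact: ccont_clamped_deriv.
  have cV : ccont (fun t => (clamped eta t - a)^-1).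
    apply: ccontV; first by move=> t; exact: clamped_avoids.
    by apply: ccontB; [exact: ccont_clamped_curve|exact: ccont_cst].
  elim: k.+2 => [|m IH]; first exact: ccont_cst.
  by under eq_fun do rewrite exprS; apply: ccontM.
- move=> t ht; have n0 : eta t - a != 0.
    by rewrite subr_eq0; apply/eqP => e; apply: (curve_avoids ht); rewrite e.
  have d := (C1_cderiv C1_re C1_im).1 t.
  have dB := cderivB d (cderiv_cst a t).
  apply: cderivE (cderivMl _ (cderivX k.+1 (cderivV n0 dB))) _.
  rewrite /clamped clamp_id // subr0 /= !exprS.
  have k0 : k.+1%:R != 0 :> R[i] by rewrite pnatr_eq0.
  by rewrite expr0 mulr1 !mulrA mulNr mulVf // invfM; ring.
Qed.

Variables (n : nat) (T : 'M[R[i]]_n.+1).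
Hypothesis S_spectrum : spectrum T `<=` S.

Lemma clamped_resolvent_ccont i j :
  ccont (fun t => invmx ((clamped eta t)%:M - T) i j).
Proof.
exact: (ccont_resolvent ccont_clamped_curve clamped_avoids S_spectrum).
Qed.

Lemma clamped_resolvent_unit t : (clamped eta t)%:M - T \in unitmx.
Proof. exact: (resolvent_unit clamped_avoids S_spectrum). Qed.

Lemma clamped_resolvent_integral i j :
  cintegral (fun t => invmx ((clamped eta t)%:M - T) i j * clamped (path_deriv eta) t)
  = (i == j)%:R * (inv_2pii R)^-1.
Proof.
exact: (integral_resolvent ccont_clamped_curve ccont_clamped_deriv clamped_avoids
  clamped_index clamped_power S_spectrum).
Qed.

End ClosedCurve.

Lemma unit_vector_scale (R : realType) n (y : 'cV[R[i]]_n) : y != 0 ->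
  exists2 s : R, 0 < s & exists2 xi : 'cV[R[i]]_n,
    xi^t* *m xi = 1%:M & y = s%:C *: xi.
Proof.
move=> y0.
pose q : R := \sum_j (re (y j 0) ^+ 2 + im (y j 0) ^+ 2).
have yy : y^t* *m y = q%:C%:M.
  rewrite [LHS]mx11_scalar; congr (_%:M); rewrite mxE /q rmorph_sum /=.
  apply: eq_bigr => j _; rewrite !mxE.
  by apply: complex_ext; rewrite !partsE ?expr2; ring.
have q0 : 0 < q.
  rewrite lt_def sumr_ge0 ?andbT; last by move=> j _; rewrite addr_ge0 ?sqr_ge0.
  apply: contra y0 => /eqP /psumr_eq0P q0; apply/eqP/colP => j; rewrite mxE; apply/eqP.
  apply: contraT => /sqr_parts_gt0; rewrite q0 ?ltxx //.
  by move=> k _; rewrite addr_ge0 ?sqr_ge0.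
pose s := Num.sqrt q; have s0 : 0 < s by rewrite sqrtr_gt0.
have sC : s%:C != 0 :> R[i] by exact: gt0_real_neq0.
exists s => //; exists (s%:C^-1 *: y); last by rewrite scalerA mulfV // scale1r.
have -> : (s%:C^-1 *: y)^t* = s%:C^-1 *: y^t*.
  apply/matrixP => i j; rewrite !mxE rmorphM /=; congr (_ * _).
  by rewrite fmorphV; congr (_^-1); apply: complex_ext; rewrite !partsE ?oppr0.
rewrite -scalemxAl -scalemxAr yy !scale_scalar_mx mulrA -invfM -expr2 -rmorphXn.
by rewrite sqr_sqrtr ?ltW // mulVf // gt0_real_neq0.
Qed.

(** [eigenvalue] speaks of row vectors, so the unit vector is the normalized adjoint of a left
    eigenvector. *)
Lemma eigenvalue_numerical_range (R : realType) n (T : 'M[R[i]]_n) z :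
  eigenvalue T z -> numerical_range T z.
Proof.
move=> /eigenvalueP[v vT v0].
have vv0 : v^t* != 0.
  apply: contra v0 => /eqP /matrixP v0; apply/eqP/rowP => j.
  by have := v0 j 0; rewrite !mxE => /eqP; rewrite conjC_eq0 => /eqP.
have [s s0 [xi xi1 vxi]] := unit_vector_scale vv0.
exists xi; split => //.
have sC : s%:C != 0 :> R[i] by exact: gt0_real_neq0.
have xiE : xi^t* = Num.conj s%:C^-1 *: v.
  have -> : xi = s%:C^-1 *: v^t* by rewrite vxi scalerA mulVf // scale1r.
  by apply/matrixP => i j; rewrite !mxE rmorphM /= conjCK.
rewrite mulmxA xiE -scalemxAl vT scalerA mulrC -scalerA -xiE -scalemxAl xi1.
by rewrite !mxE eqxx mulr1.
Qed.

Section HolomorphicCalculus.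
Variable R : realType.
Variables (Omega : set R[i]^o) (gamma : R -> R[i]^o).
Hypothesis Omega_open : open Omega.
Hypothesis Omega_convex : convex_set Omega.
Hypothesis Omega_boundary : smooth_boundary Omega gamma.
Variables (n : nat) (T : 'M[R[i]]_n.+1).
Hypothesis WT : numerical_range T `<=` Omega.

Lemma spectrum_inside : spectrum T `<=` Omega.
Proof. by move=> z hz; apply: WT; exact: eigenvalue_numerical_range. Qed.

(** This excludes the default value 0 in [hol_fc]. *)
Lemma exists_surrounds : exists eta, surrounds Omega (spectrum T) eta.
Proof.
have [s [hs s0]] := exists_eigenvalues T.
have [z0 Oz0] : exists z0, Omega z0.
  case: s hs s0 => [|a s] hs; first by rewrite big_nil => /eqP; rewrite oner_eq0.
  by exists a; apply: spectrum_inside; rewrite /spectrum /= -hs mem_head.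
have [r0 r01 hr0] := exists_dilation Omega_open Oz0 (s := s)
  ltac:(by move=> a; rewrite hs; exact: spectrum_inside).
pose r := (Num.max 0 r0 + 1) / 2.
have m0 : 0 <= Num.max 0 r0 by rewrite le_max lexx.
have m1 : Num.max 0 r0 < 1 by rewrite gt_max ltr01.
have mr : r0 <= Num.max 0 r0 by rewrite le_max lexx orbT.
have hr : r0 < r < 1 by rewrite /r; apply/andP; split; lra.
have rp : 0 < r by rewrite /r; lra.
exists (dilate gamma z0 r); apply: dilate_surrounds => //.
  by rewrite rp; case/andP: hr.
by move=> z hz; apply: (hr0 r hr rp z); rewrite hs.
Qed.

Let boundary_avoids t : 0 <= t <= 1 -> ~ Omega (gamma t).
Proof. by move=> _; exact: (@boundary_notin _ _ _ Omega_open Omega_boundary t). Qed.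

Definition boundary_resolvent t := invmx ((gamma t)%:M - T).

Lemma boundary_resolvent_unit t : (gamma t)%:M - T \in unitmx.
Proof.
have [s [hs s0]] := exists_eigenvalues T.
have ne a : a \in s -> gamma t != a.
  rewrite hs => /spectrum_inside Oa; rewrite -subr_eq0.
  exact: (boundary_subr_neq0 Omega_open Omega_boundary).
by case: (newton_resolventE s0 ne).
Qed.

Lemma boundary_resolvent_ccont i j : ccont (fun t => boundary_resolvent t i j).
Proof.
apply: (@ccont_resolvent R gamma Omega (boundary_ccont Omega_boundary) _ _ T) => //.
  by move=> a t; exact: (boundary_subr_neq0 Omega_open Omega_boundary).
exact: spectrum_inside.
Qed.

Lemma boundary_resolvent_integral i j :
  cintegral (fun t => boundary_resolvent t i j * path_deriv gamma t)
  = (i == j)%:R * (inv_2pii R)^-1.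
Proof.
rewrite -(@clamped_resolvent_integral R gamma Omega
  (smooth_C1 (sb_smooth_re Omega_boundary)) (smooth_C1 (sb_smooth_im Omega_boundary))
  (boundary_closed Omega_boundary) boundary_avoids (sb_positive Omega_boundary) n T
  spectrum_inside).
by rewrite -[LHS]cintegral_clamp.
Qed.

(** Insert the Cauchy integral of [g] into the Dunford integral and exchange the two. By the
    resolvent identity, the inner integrand over [eta] splits into the resolvent along [eta], which
    integrates to the identity, and a scalar kernel with pole [gamma t], which integrates to 0. The
    density [h] is arbitrary so as to cover both [f] and its Cauchy transform, with densities [f]
    and its conjugate on the boundary. *)
Lemma dunford_cauchy (h : R -> R[i]) (g : R[i]^o -> R[i]^o) eta : ccont h ->
  (forall z, Omega z -> g z =
    inv_2pii R * cintegral (fun t => h t / (gamma t - z) * path_deriv gamma t)) ->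
  surrounds Omega (spectrum T) eta ->
  dunford eta g T = \matrix_(i, j) (inv_2pii R *
    cintegral (fun t => h t * boundary_resolvent t i j * path_deriv gamma t)).
Proof.
move=> ch hg [C1r C1i e01 eav ein eout].
have av t : 0 <= t <= 1 -> ~ spectrum T (eta t) by move=> /eav[].
have cc := ccont_clamped_curve C1r C1i; have cc' := ccont_clamped_deriv C1r C1i.
set c := clamped eta in cc; set c' := clamped (path_deriv eta) in cc'.
have Oc s : Omega (c s) by case: (eav _ (clamp01_itv s)).
have cX i j := clamped_resolvent_ccont C1r C1i av (subset_refl (A := spectrum T)) i j.
have uX s := clamped_resolvent_unit av (subset_refl (A := spectrum T)) s.
have iX i j := clamped_resolvent_integral C1r C1i e01 av ein (subset_refl (A := spectrum T)) i j.
rewrite -/c -/c' in cX uX iX.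
have ne s t : gamma t - c s != 0.
  exact: (boundary_subr_neq0 Omega_open Omega_boundary).
have cg := boundary_ccont Omega_boundary.
have cg' := boundary_deriv_ccont Omega_boundary.
(* [gamma t] is outside the open set Omega, and the contour has index 0 about such points. *)
have index0 t : cintegral (fun s => (gamma t - c s)^-1 * c' s) = 0.
  have := eout _ (@boundary_notin _ _ _ Omega_open Omega_boundary t).
  rewrite /winding contour_int_clamped => /eqP.
  rewrite mulf_eq0 (negbTE (inv_2pii_neq0 R)) /= => /eqP i0.
  rewrite -[RHS](mulr0 (-1)) -i0 -cintegralMl; last first.
    apply: ccontM => //; apply: ccontV; last by apply: ccontB => //; exact: ccont_cst.
    by move=> s; rewrite -oppr_eq0 opprB; exact: ne.
  apply: eq_cintegral => s _; rewrite -/c -/c' mulrA; congr (_ * _).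
  by rewrite mulN1r -invrN opprB.
apply/matrixP => i j; rewrite /dunford [LHS]mxE [RHS]mxE contour_int_clamped -/c -/c'.
pose X s := invmx ((c s)%:M - T).
pose u s := inv_2pii R * (X s i j * c' s); pose v t := h t * path_deriv gamma t.
have cu : ccont u.
  by apply: ccontM; [exact: ccont_cst|apply: ccontM; [exact: cX|]].
have cv : ccont v by apply: ccontM.
apply: (congr1 (fun x => inv_2pii R * x)).
have -> : cintegral (fun s => g (c s) * X s i j * c' s) =
    cintegral (fun s => cintegral (fun t => u s * v t / (gamma t - c s))).
  apply: eq_cintegral => s _; rewrite hg // -!mulrA mulrCA mulrC -mulrA mulrC.
  rewrite -!mulrA [X in _ = X](_ : _ = u s * cintegral (fun t =>
    h t / (gamma t - c s) * path_deriv gamma t)); last first.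
    rewrite -cintegralMl; last first.
      do 2?apply: ccontM => //; apply: ccontV => //; apply: ccontB => //.
      exact: ccont_cst.
    by apply: eq_cintegral => t _; rewrite /v; ring.
  by rewrite /u; ring.
rewrite cfubini //; apply: eq_cintegral => t _.
pose Y := boundary_resolvent t.
have resolvent_identity s : X s i j * (gamma t - c s)^-1 =
    \sum_l Y i l * X s l j + Y i j * (gamma t - c s)^-1.
  have E : X s = Y *m ((gamma t - c s) *: X s + 1%:M).
    have -> : (gamma t - c s) *: X s + 1%:M = ((gamma t)%:M - T) *m X s.
      rewrite -(mulmxV (uX s)) -/(X s) -mul_scalar_mx -mulmxDl; congr (_ *m _).
      by rewrite raddfB /= subrKA.
    by rewrite mulKmx // boundary_resolvent_unit.
  have -> : X s i j = (gamma t - c s) * (\sum_l Y i l * X s l j) + Y i j.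
    rewrite {1}E mulmxDr mulmx1 mxE -scalemxAr mxE; congr (_ * _ + _).
    by rewrite mxE.
  by rewrite mulrDl mulrAC mulfV // mul1r.
have -> : cintegral (fun s => u s * v t / (gamma t - c s)) =
    v t * inv_2pii R * (\sum_l Y i l * cintegral (fun s => X s l j * c' s)
      + Y i j * cintegral (fun s => (gamma t - c s)^-1 * c' s)).
  have cV : ccont (fun s => (gamma t - c s)^-1).
    by apply: ccontV => //; apply: ccontB => //; exact: ccont_cst.
  have cXl l : ccont (fun s => X s l j * c' s) by apply: ccontM; [exact: cX|].
  have -> : \sum_l Y i l * cintegral (fun s => X s l j * c' s) =
      cintegral (fun s => \sum_l Y i l * (X s l j * c' s)).
    rewrite cintegral_sum; last by move=> l _; apply: ccontM => //; exact: ccont_cst.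
    by apply: eq_bigr => l _; rewrite cintegralMl.
  rewrite -(cintegralMl (Y i j)); last exact: ccontM.
  rewrite -cintegralD; last 2 first.
  - by apply: ccont_sum => l _; apply: ccontM => //; exact: ccont_cst.
  - by apply: ccontM; [exact: ccont_cst|exact: ccontM].
  rewrite -cintegralMl; last first.
    apply: ccontD; last by apply: ccontM; [exact: ccont_cst|exact: ccontM].
    by apply: ccont_sum => l _; apply: ccontM => //; exact: ccont_cst.
  apply: eq_cintegral => s _.
  have -> : \sum_l Y i l * (X s l j * c' s) = (\sum_l Y i l * X s l j) * c' s.
    by rewrite mulr_suml; apply: eq_bigr => l _; rewrite mulrA.
  rewrite [Y i j * _]mulrA -mulrDl -resolvent_identity /u; ring.
rewrite index0 mulr0 addr0.
under eq_bigr do rewrite iX.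
rewrite (bigD1 j) //= eqxx mul1r big1 ?addr0; last first.
  by move=> l lj; rewrite (negbTE lj) mul0r mulr0.
rewrite [Y i j * _]mulrC mulrA -[v t * _ * _]mulrA mulfV ?inv_2pii_neq0 // mulr1 /v /Y.
ring.
Qed.

Lemma hol_fc_cauchy (h : R -> R[i]) (g : R[i]^o -> R[i]^o) : ccont h ->
  (forall z, Omega z -> g z =
    inv_2pii R * cintegral (fun t => h t / (gamma t - z) * path_deriv gamma t)) ->
  hol_fc Omega g T = \matrix_(i, j) (inv_2pii R *
    cintegral (fun t => h t * boundary_resolvent t i j * path_deriv gamma t)).
Proof.
move=> ch hg; rewrite /hol_fc; case: xgetP => [X _ [eta seta ->]|none].
  exact: dunford_cauchy.
have [eta seta] := exists_surrounds.
by case: (none (dunford eta g T)); exists eta.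
Qed.

End HolomorphicCalculus.

(** * Positivity of the double layer potential *)

Section Positivity.
Variable R : realType.

Lemma is_derive_expansion (f : R -> R) (t d e : R) : is_derive t (1 : R) f d -> 0 < e ->
  exists2 r, 0 < r & forall h, `|h| < r -> `|f (t + h) - f t - h * d| <= e * `|h|.
Proof.
move=> [df <-] e0; move/cvgrPdist_lt/(_ _ e0): df => /nbhs_ballP[r /= r0 hr].
exists r => // h hh; have [->|hn0] := eqVneq h 0.
  by rewrite addr0 subrr mul0r subr0 normr0 mulr0.
have := hr h; rewrite /ball /= sub0r normrN => /(_ hh hn0).
rewrite /= /GRing.scale /= mulr1 [h + t]addrC => /ltW.
set l := lim _; rewrite -[in X in _ -> X](@ler_pM2r _ `|h|^-1) ?invr_gt0 ?normr_gt0 //.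
rewrite mulfK ?normr_eq0 // -normfV -normrM distrC.
by rewrite mulrBl [h * _ * _]mulrAC mulfV // mul1r [h^-1 * _]mulrC.
Qed.

Lemma cderiv_expansion (F : R -> R[i]) t D (e : R) : cderiv F t D -> 0 < e ->
  exists2 r, 0 < r & forall h, `|h| < r ->
    norm1 (F (t + h) - F t - h%:C * D) <= e * `|h|.
Proof.
move=> [h1 h2] e0; have e2 : 0 < e / 2 by lra.
have [r1 r10 H1] := is_derive_expansion h1 e2.
have [r2 r20 H2] := is_derive_expansion h2 e2.
exists (Num.min r1 r2); first by rewrite lt_min r10.
move=> h; rewrite lt_min => /andP[/H1 k1 /H2 k2].
by rewrite /norm1 !partsE !mul0r subr0 addr0; lra.
Qed.

Lemma integral_mean_value (f : R -> R[i]) : ccont f ->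
  exists2 t, 0 <= t <= 1 & re (cintegral f) = re (f t).
Proof.
move=> cf; have [F hF] := exists_cprimitive cf.
rewrite (cintegral_primitive cf hF) reD reN.
have dF (x : R) : 0 <= x -> is_derive x (1 : R) (fun s => re (F s)) (re (f x)).
  by move=> x0; case: (hF x ltac:(lra)).
have [t] := @MVT_segment R (fun s => re (F s)) (fun s => re (f s)) 0 1 ler01
  ltac:(by move=> x; rewrite in_itv /= => /andP[/ltW x0 _]; exact: dF)
  ltac:(by apply: derivable_within_continuous => x; rewrite in_itv /= => /andP[/dF[]]).
by rewrite in_itv /= subr0 mulr1 => ht ->; exists t.
Qed.

Lemma sqr_parts_conj (z : R[i]) : (re z ^+ 2 + im z ^+ 2)%:C = Num.conj z * z.
Proof. by apply: complex_ext; rewrite !partsE ?expr2; ring. Qed.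

Variables (Omega : set R[i]^o) (gamma : R -> R[i]^o).
Hypothesis Omega_open : open Omega.
Hypothesis Omega_convex : convex_set Omega.
Hypothesis Omega_boundary : smooth_boundary Omega gamma.

(** Division by [2 pi i] turns the tangent clockwise by a right angle: for a positively oriented
    curve this is a positive multiple of the outer normal. *)
Definition speed t : R[i] := inv_2pii R * path_deriv gamma t.
(* Up to a positive factor, the distance from [w] to the tangent at [gamma t],
   counted positively on the inner side. *)
Definition support t w : R := re (Num.conj (speed t) * (gamma t - w)).

(* Otherwise w lies on the tangent at [gamma t], and [gamma t] lies strictly
   between a point of Omega near w and a nearby point of the boundary. *)
Lemma support_neq0 t w : Omega w -> support t w != 0.
Proof.
move=> Ow; apply/eqP => s0.
have kE : inv_2pii R = 0 -i* (2 * pi)^-1.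
  apply: complex_ext; rewrite /inv_2pii ?reV ?imV /= ?mul0r //.
  by rewrite expr0n add0r expr2 invfM mulrA mulfV ?mul1r // mulf_neq0 ?pnatr_eq0 ?gt_eqF ?pi_gt0.
have i0 : im (Num.conj (path_deriv gamma t) * (gamma t - w)) = 0.
  move: s0; rewrite /support /speed kE rmorphM /=.
  set z := gamma t - w; set D := path_deriv gamma t => h.
  have : re (Num.conj (0 -i* (2 * pi)^-1 : R[i]) * Num.conj D * z) =
      - ((2 * pi)^-1 * im (Num.conj D * z)).
    by rewrite !partsE /=; ring.
  rewrite h => /esym/eqP; rewrite oppr_eq0 mulf_eq0 invr_eq0 mulf_eq0 pnatr_eq0 /=.
  by rewrite gt_eqF ?pi_gt0 //= => /eqP.
set D := path_deriv gamma t in i0.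
have D0 : D != 0 by exact: sb_regular Omega_boundary t.
pose N := re D ^+ 2 + im D ^+ 2.
have N0 : 0 < N by exact: sqr_parts_gt0.
(* [i0] says that [gamma t - w] is a real multiple of [D]; [a] is the coordinate of [w] on the
   tangent. *)
pose a : R := - re (Num.conj D * (gamma t - w)) / N.
have wE : w = gamma t + a%:C * D.
  have E : (Num.conj D * (gamma t - w)) = (- (a * N))%:C.
    apply: complex_ext; last by rewrite i0.
    by rewrite /a divfK ?opprK // lt0r_neq0.
  have NE : N%:C = Num.conj D * D by exact: sqr_parts_conj.
  have cD0 : Num.conj D != 0 by rewrite conjC_eq0.
  apply: (mulfI cD0); rewrite mulrDr mulrCA -NE -rmorphM -[in LHS](subKr (gamma t) w).
  by rewrite mulrBr E rmorphN opprK.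
have [d d0 hd] := open_norm1 Omega_open Ow.
(* A positive majorant of [|a|], which may be 0. It keeps the step [a * q] below [r] and the error
   [e] below [d * q]. *)
pose A := `|a| + 1; have A0 : 0 < A by rewrite ltr_wpDl.
have e0 : 0 < d / (2 * A) by rewrite divr_gt0 // mulr_gt0.
have [r r0 hr] := cderiv_expansion (boundary_cderiv Omega_boundary t) e0.
rewrite -/D in hr.
pose q := r / (2 * A); have q0 : 0 < q by rewrite divr_gt0 // mulr_gt0.
have aA : `|a| < A by rewrite ltrDl.
have hq : `|- a * q| < r.
  rewrite normrM normrN (gtr0_norm q0) /q mulrA ltr_pdivrMr ?mulr_gt0 //.
  by rewrite mulrC ltr_pM2l //; have := normr_ge0 a; lra.
have := hr _ hq; set p := gamma (t + _); set e := _ - _ => he.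
have pE : p = gamma t + (- a * q)%:C * D + e by rewrite /e; ring.
(* The boundary point [p] is reached by stepping away from [w] along the tangent. This correction of
   [w] makes [gamma t] exactly [(p + q w') / (1 + q)], a point of the segment from [w'] to [p] other
   than [p]. *)
pose w' := w - q^-1%:C * e.
have Ow' : Omega w'.
  apply: hd; rewrite /w' addrAC subrr add0r norm1N norm1Cl gtr0_norm ?invr_gt0 //.
  rewrite mulrC ltr_pdivrMr //; apply: le_lt_trans he _.
  rewrite normrM normrN (gtr0_norm q0) mulrA ltr_pM2r // mulrAC ltr_pdivrMr ?mulr_gt0 //.
  by rewrite ltr_pM2l //; have := normr_ge0 a; lra.
have r1 : 0 <= (1 + q)^-1 < 1.
  by rewrite invr_ge0 invf_lt1; [apply/andP; split; lra|lra].
have := segment_interior Omega_open Omega_convex Ow'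
  (@boundary_closure _ _ _ Omega_boundary (t + - a * q)) r1.
move=> Og; apply: (@boundary_notin _ _ _ Omega_open Omega_boundary t); move: Og.
rewrite -/p; congr (Omega _).
have q1 : (1 + q)%:C != 0 by apply: gt0_real_neq0; lra.
have qn : q%:C != 0 by exact: gt0_real_neq0.
rewrite pE /w' wE; clearbody a e q.
rewrite !fmorphV /= !rmorphM rmorphN /= rmorphD /= rmorph1.
rewrite rmorphD rmorph1 in q1.
by field; rewrite q1 qn.
Qed.

Lemma ccont_speed : ccont speed.
Proof. by apply: ccontM; [exact: ccont_cst|exact: boundary_deriv_ccont Omega_boundary]. Qed.

Lemma support_continuous w : continuous (support ^~ w).
Proof.
have [] : ccont (fun t => Num.conj (speed t) * (gamma t - w)) by
  apply: ccontM; [apply: ccontJ; exact: ccont_speed|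
    apply: ccontB; [exact: boundary_ccont Omega_boundary|exact: ccont_cst]].
by [].
Qed.

(** The winding number 1 is the integral of a kernel whose real part has the sign of [support], so
    [support] is positive at some parameter. It is continuous and never 0, hence positive
    everywhere. *)
Lemma support_gt0 t w : Omega w -> 0 < support t w.
Proof.
move=> Ow.
have cf : ccont (fun t => (gamma t - w)^-1 * speed t).
  by apply: ccontM; [exact: (ccont_boundary_inv Omega_open Omega_boundary)|exact: ccont_speed].
have [t1 _] := integral_mean_value cf.
have -> : cintegral (fun t => (gamma t - w)^-1 * speed t) = 1.
  rewrite -(sb_positive Omega_boundary Ow) /winding contour_intE -cintegralMl.
    by apply: eq_cintegral => s _; rewrite /speed mulrCA.
  apply: ccontM; first exact: (ccont_boundary_inv Omega_open Omega_boundary).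
  exact: boundary_deriv_ccont Omega_boundary.
have n0 := boundary_subr_neq0 Omega_open Omega_boundary t1 Ow.
have s1 : re ((gamma t1 - w)^-1 * speed t1) =
    support t1 w / (re (gamma t1 - w) ^+ 2 + im (gamma t1 - w) ^+ 2).
  by rewrite /support [in LHS]reM reV imV [in RHS]reM reJ imJ; ring.
rewrite s1 re1 => e1.
have p1 : 0 < support t1 w.
  have := ltr01 (R := R); rewrite e1 pmulr_lgt0 // invr_gt0; exact: sqr_parts_gt0.
rewrite lt_neqAle eq_sym support_neq0 //= leNgt; apply/negP => p2.
have [tt|tt] := leP t t1.
  have [|c _ c0] := @IVT R (support ^~ w) t t1 0 tt
    (continuous_subspaceT (@support_continuous w)).
    by rewrite ge_min le_max (ltW p1) (ltW p2) orbT.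
  by have := support_neq0 c Ow; rewrite c0 eqxx.
have [|c _ c0] := @IVT R (support ^~ w) t1 t 0 (ltW tt)
  (continuous_subspaceT (@support_continuous w)).
  by rewrite ge_min le_max (ltW p1) (ltW p2) orbT.
by have := support_neq0 c Ow; rewrite c0 eqxx.
Qed.

End Positivity.

(** * The double layer kernel of a matrix and conic decompositions *)

Lemma adjmxE (C : numClosedFieldType) m n (M : 'M[C]_(m, n)) i j :
  M^t* i j = Num.conj (M j i).
Proof. by rewrite !mxE. Qed.

Lemma adjmxM (C : numClosedFieldType) m n p (A : 'M[C]_(m, n)) (B : 'M[C]_(n, p)) :
  (A *m B)^t* = B^t* *m A^t*.
Proof. by rewrite trmx_mul map_mxM. Qed.

Section Kernel.
Variable R : realType.
Variables (Omega : set R[i]^o) (gamma : R -> R[i]^o).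
Hypothesis Omega_open : open Omega.
Hypothesis Omega_convex : convex_set Omega.
Hypothesis Omega_boundary : smooth_boundary Omega gamma.
Variables (n : nat) (T : 'M[R[i]]_n.+1).
Hypothesis WT : numerical_range T `<=` Omega.

Definition cauchy_density t : 'M[R[i]]_n.+1 := speed gamma t *: boundary_resolvent gamma T t.

(* The double layer potential kernel of T, as a density with respect to dt. *)
Definition double_layer t : 'M[R[i]]_n.+1 := cauchy_density t + (cauchy_density t)^t*.

Lemma cauchy_density_ccont i j : ccont (fun t => cauchy_density t i j).
Proof.
under eq_fun do rewrite mxE; apply: ccontM; first exact: ccont_speed Omega_boundary.
exact: (boundary_resolvent_ccont Omega_open Omega_boundary WT).
Qed.

Lemma double_layerE t i j :
  double_layer t i j = cauchy_density t i j + Num.conj (cauchy_density t j i).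
Proof. by rewrite mxE adjmxE. Qed.

Lemma double_layer_ccont i j : ccont (fun t => double_layer t i j).
Proof.
under eq_fun do rewrite double_layerE; apply: ccontD; first exact: cauchy_density_ccont.
by apply: ccontJ; exact: cauchy_density_ccont.
Qed.

Lemma double_layer_hermitian t : (double_layer t)^t* = double_layer t.
Proof.
apply/matrixP => i j; rewrite adjmxE !double_layerE rmorphD /= conjCK; exact: addrC.
Qed.

(** With [A = gamma t - T] and [x = A^* y], the form [x^* A^-1 x] becomes the conjugate of
    [y^* A y]. The kernel at [x] is therefore twice the real part of [y^* A y] times the conjugate
    of [speed], that is [2 |y|^2] times [support] at a point of the numerical range. *)
Lemma double_layer_ge0 t (x : 'cV[R[i]]_n.+1) :
  0 <= (x^t* *m double_layer t *m x) 0 0.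
Proof.
pose Y := boundary_resolvent gamma T t; pose A := (gamma t)%:M - T.
have uA : A \in unitmx by exact: (boundary_resolvent_unit Omega_open Omega_boundary WT).
pose y := Y^t* *m x.
have xE : x = A^t* *m y.
  by rewrite /y mulmxA -map_mxM -trmx_mul /Y /boundary_resolvent mulVmx // trmx1 map_mx1 mul1mx.
pose al := (y^t* *m A *m y) 0 0.
have E1 : (x^t* *m Y *m x) 0 0 = Num.conj al.
  have -> : x^t* *m Y *m x = (y^t* *m A *m y)^t*.
    have -> : x^t* *m Y = y^t* by rewrite /y adjmxM trmxCK.
    by rewrite xE [RHS]adjmxM [(y^t* *m A)^t*]adjmxM trmxCK mulmxA.
  by rewrite adjmxE.
have E2 : (x^t* *m Y^t* *m x) 0 0 = al.
  have -> : x^t* *m Y^t* *m x = (x^t* *m Y *m x)^t*.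
    by rewrite [RHS]adjmxM [in RHS]adjmxM trmxCK mulmxA.
  by rewrite adjmxE E1 conjCK.
have -> : (x^t* *m double_layer t *m x) 0 0 =
    speed gamma t * Num.conj al + Num.conj (speed gamma t) * al.
  rewrite -E1 -E2 /double_layer /cauchy_density -/Y mulmxDr mulmxDl mxE; congr (_ + _).
    by rewrite -scalemxAr -scalemxAl mxE.
  have -> : (speed gamma t *: Y)^t* = Num.conj (speed gamma t) *: Y^t*.
    by apply/matrixP => i j; rewrite !mxE rmorphM.
  by rewrite -scalemxAr -scalemxAl mxE.
have -> : speed gamma t * Num.conj al + Num.conj (speed gamma t) * al =
    (2 * re (Num.conj (speed gamma t) * al))%:C.
  by apply: complex_ext; rewrite !partsE; ring.
rewrite ler0c mulr_ge0 //.
have [y0|y0] := eqVneq y 0.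
  by rewrite /al y0 mulmx0 mxE mulr0.
have [s s0 [xi xi1 yE]] := unit_vector_scale y0.
have -> : al = (s ^+ 2)%:C * (gamma t - (xi^t* *m (T *m xi)) 0 0).
  have ysE : y^t* = s%:C *: xi^t*.
    apply/matrixP => i j; rewrite yE !mxE rmorphM /=; congr (_ * _).
    by apply: complex_ext; rewrite !partsE ?oppr0.
  rewrite /al ysE yE -scalemxAr -!scalemxAl scalerA mxE rmorphXn expr2.
  congr (_ * _); rewrite /A mulmxBr mul_mx_scalar mulmxBl -scalemxAl xi1 mulmxA.
  by rewrite !mxE eqxx mulr1.
rewrite mulrCA reM reC imC mul0r subr0 mulr_ge0 ?sqr_ge0 // ltW //.
apply: (support_gt0 Omega_open Omega_convex Omega_boundary).
by apply: WT; exists xi.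
Qed.

Lemma double_layer_integral i j :
  cintegral (fun t => double_layer t i j) = 2 * (i == j)%:R.
Proof.
have E k l : cintegral (fun t => cauchy_density t k l) = (k == l)%:R.
  have := boundary_resolvent_integral Omega_open Omega_boundary WT k l.
  move=> /(congr1 (fun x => inv_2pii R * x)); rewrite mulrCA mulfV ?inv_2pii_neq0 // mulr1.
  rewrite -cintegralMl; last first.
    by apply: ccontM; [exact: (boundary_resolvent_ccont Omega_open Omega_boundary WT)|exact: boundary_deriv_ccont Omega_boundary].
  move=> <-; apply: eq_cintegral => t _; rewrite mxE /speed; ring.
under eq_cintegral do rewrite double_layerE.
rewrite cintegralD; [|exact: cauchy_density_ccont|apply: ccontJ; exact: cauchy_density_ccont].
rewrite cintegralJ; last exact: cauchy_density_ccont.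
by rewrite !E rmorph_nat eq_sym mulr2n mulrDl mul1r.
Qed.

(** Both terms are boundary integrals against [cauchy_density], with [f] and with its conjugate. The
    adjoint of the second integrates [f] against the adjoint density, and the two densities add up
    to the kernel. *)
Lemma double_layer_calculus f i j : A_alg Omega f ->
  (hol_fc Omega f T + (hol_fc Omega (cauchy_conj gamma f) T)^t*) i j =
  cintegral (fun t => f (gamma t) * double_layer t i j).
Proof.
move=> Af; have cf := A_alg_ccont Omega_boundary Af.
have cfJ := ccontJ cf.
rewrite (hol_fc_cauchy Omega_open Omega_convex Omega_boundary WT cf); last first.
  by move=> z Oz; rewrite -(cauchy_formula Omega_open Omega_convex Omega_boundary Af Oz).
rewrite (hol_fc_cauchy Omega_open Omega_convex Omega_boundary WT cfJ); last by [].
have cfY (h : R -> R[i]) k l : ccont h ->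
    ccont (fun t => h t * boundary_resolvent gamma T t k l * path_deriv gamma t).
  move=> ch; apply: ccontM; last exact: boundary_deriv_ccont Omega_boundary.
  by apply: ccontM => //; exact: (boundary_resolvent_ccont Omega_open Omega_boundary WT).
have E (h : R -> R[i]) k l : ccont h -> inv_2pii R *
    cintegral (fun t => h t * boundary_resolvent gamma T t k l * path_deriv gamma t) =
    cintegral (fun t => h t * cauchy_density t k l).
  move=> ch; rewrite -cintegralMl; last exact: cfY.
  by apply: eq_cintegral => t _; rewrite mxE /speed; ring.
rewrite [LHS]mxE [X in X + _]mxE [X in _ + X]adjmxE [X in _ + Num.conj X]mxE !E // -cintegralJ; last first.
  by apply: ccontM => //; exact: cauchy_density_ccont.
rewrite -cintegralD; last 2 first.
- by apply: ccontM => //; exact: cauchy_density_ccont.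
- by apply: ccontJ; apply: ccontM => //; exact: cauchy_density_ccont.
by apply: eq_cintegral => t _; rewrite double_layerE mulrDr rmorphM /= conjCK.
Qed.

End Kernel.

Section RankOne.
Variable C : numClosedFieldType.

Lemma psd_sum_rank_one n (M : 'M[C]_n) : M^t* = M ->
  (forall x : 'cV_n, 0 <= (x^t* *m M *m x) 0 0) ->
  exists v : 'I_n -> 'cV[C]_n, M = \sum_k v k *m (v k)^t*.
Proof.
move=> hM pM.
have nM : M \is normalmx by apply/normalmxP; rewrite hM.
pose P := spectralmx M; pose D := spectral_diag M.
have uP : P \is unitarymx by exact: spectral_unitarymx.
have ME : M = P^t* *m diag_mx D *m P.
  by rewrite -invmx_unitary //; exact/orthomx_spectralP.
have PP : P *m P^t* = 1%:M by exact/unitarymxP.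
have D0 k : 0 <= D 0 k.
  have := pM (P^t* *m delta_mx k 0).
  rewrite trmx_mul map_mxM trmxCK [in X in 0 <= X -> _]ME !mulmxA.
  rewrite -[_ *m P *m P^t*]mulmxA PP mulmx1 -[_ *m P *m P^t*]mulmxA PP mulmx1.
  by rewrite trmx_delta map_delta_mx -rowE -colE !mxE eqxx mulr1n.
exists (fun k => sqrtC (D 0 k) *: (row k P)^t*).
apply/matrixP => i j; rewrite [in LHS]ME summxE mxE; apply: eq_bigr => k _.
have sR : Num.conj (sqrtC (D 0 k)) = sqrtC (D 0 k).
  by apply: conj_Creal; apply: ger0_real; rewrite sqrtC_ge0.
have -> : (sqrtC (D 0 k) *: (row k P)^t*)^t* = sqrtC (D 0 k) *: row k P.
  by apply/matrixP => a b; rewrite !mxE rmorphM /= sR conjCK.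
rewrite -scalemxAl -scalemxAr scalerA -expr2 sqrtCK [in RHS]mxE [in RHS]mxE big_ord1.
rewrite mul_mx_diag !mxE; ring.
Qed.

End RankOne.

Section Caratheodory.
Variable R : realFieldType.

(** [S] is closed under nonnegative multiples but not under sums, so terms may only be rescaled.
    Subtracting a linear relation divided by its largest coefficient leaves all factors nonnegative
    and kills the term where the maximum is attained. *)
Lemma cone_sum_drop D (S : set 'rV[R]_D) k (x : 'I_k.+1 -> 'rV[R]_D) :
  (forall (c : R) y, 0 <= c -> S y -> S (c *: y)) -> (D <= k)%N ->
  (forall i, S (x i)) ->
  exists2 y : 'I_k -> 'rV[R]_D, forall i, S (y i) & \sum_i x i = \sum_i y i.
Proof.
move=> Sc Dk Sx; pose X := \matrix_i x i.
have [al alX [i1 ali1]] : exists2 al : 'rV[R]_k.+1, al *m X = 0 & exists i, 0 < al 0 i.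
  have : kermx X != 0.
    rewrite -mxrank_eq0 mxrank_ker -lt0n subn_gt0.
    by rewrite (leq_ltn_trans (rank_leq_col X)) // ltnS.
  move=> /rowV0Pn[v /sub_kermxP vX /rV0Pn[i vi]].
  have [vi0|vi0] := ltrP 0 (v 0 i); first by exists v => //; exists i.
  exists (- v); first by rewrite mulNmx vX oppr0.
  by exists i; rewrite mxE oppr_gt0 lt_neqAle vi vi0.
pose i0 := [arg max_(i > i1) al 0 i]%O.
have [i0P i0max] : 0 < al 0 i0 /\ forall i, al 0 i <= al 0 i0.
  rewrite /i0; case: arg_maxP => // i _ h; split; last by move=> j; exact: h.
  by apply: lt_le_trans ali1 _; exact: h.
pose y i := (1 - al 0 i / al 0 i0) *: x i.
have y0 : y i0 = 0 by rewrite /y divff ?subrr ?scale0r // lt0r_neq0.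
have Sy i : S (y i).
  by apply: Sc => //; rewrite subr_ge0 ler_pdivrMr // mul1r.
exists (fun i => y (lift i0 i)) => //.
have <- : \sum_i y i = \sum_i x i.
  have Z : \sum_i ((al 0 i0)^-1 * al 0 i) *: x i = (al 0 i0)^-1 *: (al *m X).
    rewrite mulmx_sum_row scaler_sumr.
    by apply: eq_bigr => i _; rewrite scalerA rowK.
  rewrite alX scaler0 in Z; transitivity (\sum_i x i - \sum_i ((al 0 i0)^-1 * al 0 i) *: x i).
    rewrite -sumrB; apply: eq_bigr => i _.
    by rewrite /y scalerBl scale1r mulrC.
  by rewrite Z subr0.
by rewrite (bigD1_ord i0) //= y0 add0r.
Qed.

Lemma cone_caratheodory D (S : set 'rV[R]_D) k (x : 'I_k -> 'rV[R]_D) :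
  (forall (c : R) y, 0 <= c -> S y -> S (c *: y)) -> S 0 ->
  (forall i, S (x i)) ->
  exists2 y : 'I_D -> 'rV[R]_D, forall i, S (y i) & \sum_i x i = \sum_i y i.
Proof.
move=> Sc S0; have [m] := ubnP k; elim: m k x => // m IH k x km Sx.
have [kD|Dk] := leqP k D.
  (* Short sums are padded with 0, so that the number of terms is always exactly [D]. *)
  pose F m : 'rV[R]_D := if insub m is Some j then x j else 0.
  exists (fun i : 'I_D => F i); first by move=> i; rewrite /F; case: insubP.
  rewrite (eq_bigr (fun i : 'I_k => F i)); last by move=> i _; rewrite /F valK.
  rewrite (big_ord_widen D F kD) big_mkcond; apply: eq_bigr => i _.
  by case: ifPn => // ki; rewrite /F insubF //; exact: negbTE.
case: k x km Dk Sx => // k x km Dk Sx.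
have [y Sy ->] := @cone_sum_drop D S k x Sc Dk Sx.
by apply: IH => //; rewrite -ltnS.
Qed.

End Caratheodory.

(** * Quadrature *)

Section RiemannSums.
Variable R : realType.

Lemma uniform_continuity (f : R -> R[i]) (e : R) : ccont f -> 0 < e ->
  exists2 d, 0 < d & forall s t, 0 <= s <= 1 -> `|t - s| < d -> norm1 (f t - f s) <= e.
Proof.
move=> /ccontP cf e0.
apply: (@interval_bisection R (fun a b => exists2 d, 0 < d & forall s t,
  a <= s <= b -> `|t - s| < d -> norm1 (f t - f s) <= e)).
  move=> a b c ab bc [d d0 hd] [d' d'0 hd']; exists (Num.min d d'); first by rewrite lt_min d0.
  move=> s t /andP[sa sc]; rewrite lt_min => /andP[h1 h2].
  by have [sb|/ltW sb] := leP s b; [apply: hd|apply: hd'] => //; rewrite ?sa ?sb.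
move=> p _; have e2 : 0 < e / 2 by lra.
have [d d0 hd] := cf p _ e2; have d2 : 0 < d / 2 by lra.
exists (d / 2) => // a b /andP[a0 ap] /andP[pb b1] /andP[_ ba]; exists (d / 2) => //.
move=> s t /andP[sa sb]; rewrite ltr_norml => /andP[h1 h2].
have hs : norm1 (f s - f p) < e / 2 by apply: hd; rewrite ltr_norml; apply/andP; split; lra.
have ht : norm1 (f t - f p) < e / 2 by apply: hd; rewrite ltr_norml; apply/andP; split; lra.
apply: le_trans (norm1_tri (f p) _ _) _; rewrite (norm1B (f p)); lra.
Qed.

Definition riemann_sum (f : R -> R[i]) N : R[i] :=
  \sum_(l < N) (N%:R^-1)%:C * f (l%:R / N%:R).

Lemma riemann_sum_approx (f : R -> R[i]) (e : R) : ccont f -> 0 < e ->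
  exists N0, forall N, (N0 < N)%N -> norm1 (riemann_sum f N - cintegral f) <= e.
Proof.
move=> cf e0; have e2 : 0 < e / 2 by lra.
have [d d0 hd] := uniform_continuity cf e2.
exists (Num.truncn d^-1) => N hN.
have N0 : 0 < N%:R :> R by rewrite ltr0n (leq_ltn_trans _ hN).
have Nd : N%:R^-1 < d.
  rewrite -[d]invrK ltf_pV2 ?posrE ?invr_gt0 //; apply: lt_le_trans (truncnS_gt _) _.
  by rewrite ler_nat.
have [F hF] := exists_cprimitive cf; rewrite (cintegral_primitive cf hF).
have -> : F 1 - F 0 = \sum_(l < N) (F (l.+1%:R / N%:R) - F (l%:R / N%:R)).
  rewrite -(big_mkord xpredT (fun l => F (l.+1%:R / N%:R) - F (l%:R / N%:R))).
  by rewrite telescope_sumr // mul0r mulfV // gt_eqF.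
rewrite /riemann_sum -sumrB; apply: le_trans (norm1_sum _ _ _) _.
have -> : e = \sum_(l < N) (e / N%:R).
  by rewrite sumr_const card_ord -[RHS]mulr_natr divfK // gt_eqF.
apply: ler_sum => l _; set a := l%:R / N%:R.
have -> : l.+1%:R / N%:R = a + N%:R^-1 by rewrite -natr1 mulrDl mul1r.
set h := N%:R^-1; have h0 : 0 < h by rewrite invr_gt0.
have hd' : h < d by [].
have a0 : 0 <= a by rewrite divr_ge0 // ler0n.
have a1 : a + h <= 1.
  by rewrite /a /h -{2}[N%:R^-1]mul1r -mulrDl natr1 ler_pdivrMr // mul1r ler_nat.
have aN x : a <= x -> -1 < x by move=> ax; rewrite (lt_le_trans _ (le_trans a0 ax)) // ltrN10.
clearbody a h.
(* The error on a cell is the increment of [f a * s - F s], whose derivative [f a - f s] is at most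
   [e / 2] there. *)
have E : h%:C * f a - (F (a + h) - F a) =
    (f a * (a + h)%:C - F (a + h)) - (f a * a%:C - F a).
  by rewrite rmorphD; ring.
have ale : a <= a + h by rewrite lerDl ltW.
have hh : a + h - a = h by ring.
have -> : e * h = 2 * (e / 2 * (a + h - a)) by rewrite hh; field.
rewrite E; apply: (@cincrement_bound R (fun s => f a - f s) (fun s => f a * s%:C - F s)) => //.
  move=> x /andP[ax _]; apply: cderivB; last by apply: hF; exact: aN.
  by apply: cderivE (cderivMl (f a) (cderiv_real (is_derive_id x 1))) _; exact: mulr1.
move=> x /andP[ax xh]; rewrite norm1B; apply: hd; first by apply/andP; split; lra.
by rewrite ltr_norml; apply/andP; split; lra.
Qed.

End RiemannSums.

Section Quadrature.
Variable R : realType.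
Variables (n d : nat) (M : R -> 'M[R[i]]_n) (psi : 'I_d.+1 -> R -> R[i]).
Hypothesis M_ccont : forall i j, ccont (fun t => M t i j).
Hypothesis M_hermitian : forall t, (M t)^t* = M t.
Hypothesis M_ge0 : forall t (x : 'cV[R[i]]_n), 0 <= (x^t* *m M t *m x) 0 0.
Hypothesis psi_ccont : forall k, ccont (psi k).
Hypothesis psi0 : forall t, psi ord0 t = 1.

(** The real coordinates of a family of complex matrices indexed by the functions [psi k]; [bool]
    separates real and imaginary parts. Their number bounds the quadrature, whatever the mesh of the
    Riemann sums. *)
Let I : finType := (bool * ('I_d.+1 * ('I_n * 'I_n)))%type.
Let D := #|I|.

Let encode (X : 'I_d.+1 -> 'I_n -> 'I_n -> R[i]) : 'rV[R]_D :=
  \row_m let: (b, (k, (i, j))) := enum_val m in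
    if b then re (X k i j) else im (X k i j).

Let encode_inj X Y : encode X = encode Y -> forall k i j, X k i j = Y k i j.
Proof.
move=> /rowP e k i j; apply: complex_ext.
  by have := e (enum_rank (true, (k, (i, j)))); rewrite !mxE enum_rankK.
by have := e (enum_rank (false, (k, (i, j)))); rewrite !mxE enum_rankK.
Qed.

Let encodeD X Y : encode (fun k i j => X k i j + Y k i j) = encode X + encode Y.
Proof.
apply/rowP => m; rewrite !mxE; case: (enum_val m) => b [k [i j]].
by case: b; rewrite ?reD ?imD.
Qed.

Let encodeZ (c : R) X : encode (fun k i j => c%:C * X k i j) = c *: encode X.
Proof.
apply/rowP => m; rewrite !mxE; case: (enum_val m) => b [k [i j]].
by case: b; rewrite !partsE mul0r ?subr0 ?addr0.
Qed.

Let encode0 : encode (fun _ _ _ => 0) = 0.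
Proof.
by apply/rowP => m; rewrite !mxE; case: (enum_val m) => b [k [i j]]; case: b.
Qed.

(** The contribution of one node: all [psi k] are evaluated at the same [t] and multiply the same
    rank-one matrix, so that one row of the isometry can represent it. *)
Let atom (t : R) (v : 'cV[R[i]]_n) k i j : R[i] :=
  psi k t * (v i 0 * Num.conj (v j 0)).

Let S : set 'rV[R]_D := [set x | exists t v, 0 <= t <= 1 /\ x = encode (atom t v)].

Let S_cone (c : R) y : 0 <= c -> S y -> S (c *: y).
Proof.
move=> c0 [t [v [ht ->]]]; exists t, ((Num.sqrt c)%:C *: v); split => //.
rewrite -encodeZ; congr encode; apply/funext => k; apply/funext => i; apply/funext => j.
rewrite /atom !mxE rmorphM /=.
have -> : Num.conj (Num.sqrt c)%:C = (Num.sqrt c)%:C :> R[i].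
  by apply: complex_ext; rewrite !partsE ?oppr0.
rewrite -{1}(sqr_sqrtr c0) rmorphXn /= expr2; ring.
Qed.

Let S_0 : S 0.
Proof.
exists 0, 0; split; first by rewrite lexx ler01.
rewrite -encode0; congr encode; apply/funext => k; apply/funext => i; apply/funext => j.
by rewrite /atom !mxE mul0r mulr0.
Qed.

(** The convex cone generated by [S]: Caratheodory's theorem makes it stable under sums although the
    number of terms is fixed. *)
Let Q (x : 'rV[R]_D) := exists2 y : 'I_D -> 'rV[R]_D, forall l, S (y l) & x = \sum_l y l.

Let Q_S x : S x -> Q x.
Proof.
move=> Sx; have [y Sy e] := @cone_caratheodory R D S 1 (fun=> x) S_cone S_0 (fun=> Sx).
by exists y; rewrite // -e big_ord1.
Qed.

Let Q_add x y : Q x -> Q y -> Q (x + y).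
Proof.
move=> [x' Sx' ->] [y' Sy' ->].
pose z (l : 'I_(D + D)) := match fintype.split l with inl a => x' a | inr b => y' b end.
have Sz l : S (z l) by rewrite /z; case: fintype.split.
have [w Sw e] := @cone_caratheodory R D S _ z S_cone S_0 Sz.
exists w => //; rewrite -e big_split_ord /=; congr (_ + _); apply: eq_bigr => l _.
  by rewrite /z (unsplitK (inl l)).
by rewrite /z (unsplitK (inr l)).
Qed.

Let Q_sum (J : Type) (r : seq J) (F : J -> 'rV[R]_D) :
  (forall l, Q (F l)) -> Q (\sum_(l <- r) F l).
Proof.
move=> h; elim: r => [|l r IH]; first by rewrite big_nil; exact: Q_S.
by rewrite big_cons; apply: Q_add.
Qed.

Let encode_sum (J : Type) (r : seq J) (F : J -> 'I_d.+1 -> 'I_n -> 'I_n -> R[i]) :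
  encode (fun k i j => \sum_(l <- r) F l k i j) = \sum_(l <- r) encode (F l).
Proof.
elim: r => [|l r IH].
  rewrite big_nil -encode0; congr encode.
  by apply/funext => k; apply/funext => i; apply/funext => j; rewrite big_nil.
rewrite big_cons -IH -encodeD; congr encode.
by apply/funext => k; apply/funext => i; apply/funext => j; rewrite big_cons.
Qed.

Let node_Q (c t : R) : 0 <= c -> 0 <= t <= 1 ->
  Q (encode (fun k i j => c%:C * (psi k t * M t i j))).
Proof.
move=> c0 ht; have [v Mv] := psd_sum_rank_one (M_hermitian t) (M_ge0 t).
have -> : (fun k i j => c%:C * (psi k t * M t i j)) =
    (fun k i j => \sum_l c%:C * atom t (v l) k i j).
  apply/funext => k; apply/funext => i; apply/funext => j.
  rewrite Mv summxE !mulr_sumr; apply: eq_bigr => l _.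
  by rewrite /atom [X in psi k t * X]mxE big_ord1 !mxE.
rewrite encode_sum; apply: Q_sum => l; apply: Q_S; rewrite encodeZ; apply: S_cone => //.
by exists t, (v l).
Qed.

Let riemann_Q N : Q (encode (fun k i j => riemann_sum (fun t => psi k t * M t i j) N)).
Proof.
rewrite /riemann_sum encode_sum; apply: Q_sum => l.
have N0 : (0 < N)%N by apply: leq_ltn_trans (ltn_ord l).
apply: node_Q; first by rewrite invr_ge0 ler0n.
by rewrite divr_ge0 ?ler0n //= ler_pdivrMr ?ltr0n // mul1r ler_nat ltnW.
Qed.

Let Q_nodes X : Q (encode X) -> exists t : 'I_D -> R, exists v : 'I_D -> 'cV[R[i]]_n,
  (forall l, 0 <= t l <= 1) /\ forall k i j, X k i j = \sum_l atom (t l) (v l) k i j.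
Proof.
move=> [y Sy e].
have [t /choice[v htv]] := choice Sy; exists t, v; split; first by move=> l; case: (htv l).
apply: encode_inj; rewrite encode_sum e; apply: eq_bigr => l _; by case: (htv l).
Qed.

Let V k i j : R[i] := cintegral (fun t => psi k t * M t i j).

Let approx (e : R) : 0 < e -> exists t : 'I_D -> R, exists v : 'I_D -> 'cV[R[i]]_n,
  (forall l, 0 <= t l <= 1) /\
  forall k i j, norm1 (\sum_l atom (t l) (v l) k i j - V k i j) <= e.
Proof.
move=> e0.
have cf k i j : ccont (fun t => psi k t * M t i j) by exact: ccontM.
have [N0 hN0] := choice (fun q : 'I_d.+1 * ('I_n * 'I_n) =>
  riemann_sum_approx (cf q.1 q.2.1 q.2.2) e0).
pose N := (\max_q N0 q).+1.
have [t [v [ht hv]]] := Q_nodes (riemann_Q N).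
exists t, v; split => // k i j; rewrite -hv.
by apply: (hN0 (k, (i, j))); rewrite ltnS; apply: leq_bigmax.
Qed.

(** Since [psi ord0] is 1, the diagonal entries of an approximate quadrature are sums of squared
    moduli of coordinates of the [v l], and so bound each of them. The 2 leaves room for the
    approximation error and for passing from squares to moduli. *)
Let B : R := 2 + \sum_i norm1 (V ord0 i i).

Let nodes_bounded (t : 'I_D -> R) (v : 'I_D -> 'cV[R[i]]_n) l i :
  (forall k i j, norm1 (\sum_l atom (t l) (v l) k i j - V k i j) <= 1) ->
  `|re (v l i 0)| <= B /\ `|im (v l i 0)| <= B.
Proof.
move=> h; pose q l := re (v l i 0) ^+ 2 + im (v l i 0) ^+ 2.
have q0 l' : 0 <= q l' by rewrite addr_ge0 ?sqr_ge0.
have E : re (\sum_l atom (t l) (v l) ord0 i i) = \sum_l q l.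
  rewrite re_sum; apply: eq_bigr => l' _; rewrite /atom psi0 mul1r /q !partsE !expr2; ring.
have VB : norm1 (V ord0 i i) <= B - 2.
  rewrite /B addrC addKr (bigD1 i) //= lerDl sumr_ge0 // => j _; exact: norm1_ge0.
have qB : q l <= B - 1.
  have := h ord0 i i; have := re_le_norm1 (\sum_l atom (t l) (v l) ord0 i i - V ord0 i i).
  have := re_le_norm1 (V ord0 i i); rewrite reD reN E (bigD1 l) //=.
  have s0 : 0 <= \sum_(l' < D | l' != l) q l' by apply: sumr_ge0.
  move=> h1 h2 h3; have := ler_norm (re (V ord0 i i)).
  have := ler_norm (q l + \sum_(l' < D | l' != l) q l' - re (V ord0 i i)); lra.
have B1 : 1 <= B by have := norm1_ge0 (V ord0 i i); lra.
have sq (x y : R) : x ^+ 2 + y ^+ 2 <= B - 1 -> `|x| <= B.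
  move=> hxy; rewrite leNgt; apply/negP => Bx.
  have : B * B <= `|x| * `|x| by apply: ler_pM => //; lra.
  rewrite -[`|x| * _]expr2 real_normK ?num_real // => h1.
  have := sqr_ge0 y; have : B * 1 <= B * B by apply: ler_wpM2l; lra.
  lra.
by split; [apply: (sq _ (im (v l i 0)))|apply: (sq _ (re (v l i 0))); rewrite addrC].
Qed.

(** Coordinates of a configuration: [None] holds the node, [Some (b, i)] one part of the entry [i]
    of the vector. Configurations thus range over a compact product of segments. *)
Let J : finType := ('I_D * option (bool * 'I_n))%type.

Let node_of (x : 'rV[R]_#|J|) l : R := x ord0 (enum_rank (l, None)).
Let vector_of (x : 'rV[R]_#|J|) l : 'cV[R[i]]_n :=
  \col_i (x ord0 (enum_rank (l, Some (true, i))) +i*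
          x ord0 (enum_rank (l, Some (false, i)))).

Let box (m : 'I_#|J|) : set R :=
  if (enum_val m).2 is None then `[0, 1]%classic else `[(- B), B]%classic.

Let objective (x : 'rV[R]_#|J|) : R := \sum_(q : 'I_d.+1 * ('I_n * 'I_n))
  norm1 (\sum_l atom (node_of x l) (vector_of x l) q.1 q.2.1 q.2.2 - V q.1 q.2.1 q.2.2).

Let objective_continuous : continuous objective.
Proof.
have cc m : continuous (fun x : 'rV[R]_#|J| => x ord0 m) by exact: coord_continuous.
have sumc (r : seq ('I_d.+1 * ('I_n * 'I_n))) (h : _ -> 'rV[R]_#|J| -> R) :
    (forall q, continuous (h q)) -> continuous (fun x => \sum_(q <- r) h q x).
  move=> ch; elim: r => [|q r IH].
    by under eq_fun do rewrite big_nil; move=> x; exact: cst_continuous.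
  by under eq_fun do rewrite big_cons; apply: contD.
apply: sumc => q.
have cv l i : ccont (fun x => vector_of x l i 0).
  by under eq_fun do rewrite mxE; split => /=; exact: cc.
have [c1 c2] : ccont (fun x => \sum_l atom (node_of x l) (vector_of x l) q.1 q.2.1 q.2.2
    - V q.1 q.2.1 q.2.2).
  apply: ccontB; last exact: ccont_cst.
  apply: ccont_sum => l _; apply: ccontM.
    exact: (ccont_comp (psi_ccont q.1) (cc _)).
  by apply: ccontM => //; apply: ccontJ.
have cn (h : 'rV[R]_#|J| -> R) : continuous h -> continuous (fun x => `|h x|).
  by move=> ch x; have := @cvg_norm _ R^o _ _ _ h (h x) (ch x); apply.
by apply: contD; exact: cn.
Qed.

(** Approximate quadratures have a fixed number of nodes and bounded vectors, so the total error
    attains its minimum on a compact box. Riemann sums make the error arbitrarily small, hence the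
    minimum is 0. *)
Lemma quadrature : exists t : 'I_D -> R, exists v : 'I_D -> 'cV[R[i]]_n,
  (forall l, 0 <= t l <= 1) /\ forall k i j,
    cintegral (fun s => psi k s * M s i j) =
    \sum_l psi k (t l) * (v l i 0 * Num.conj (v l j 0)).
Proof.
pose A : set 'rV[R]_#|J| := [set x | forall m, box m (x ord0 m)].
have cA : compact A.
  apply: rV_compact => m; rewrite /box; case: (enum_val m).2 => [_|]; exact: segment_compact.
have in_A (e : R) : 0 < e -> e <= 1 -> exists2 x, A x & objective x <= e *+ #|{: 'I_d.+1 * ('I_n * 'I_n)}|.
  move=> e0 e1; have [t [v [ht hv]]] := approx e0.
  pose x : 'rV[R]_#|J| := \row_m match (enum_val m).2 with
    | None => t (enum_val m).1
    | Some (true, i) => re (v (enum_val m).1 i 0)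
    | Some (false, i) => im (v (enum_val m).1 i 0) end.
  have xt l : node_of x l = t l by rewrite /node_of mxE enum_rankK.
  have xv l : vector_of x l = v l.
    apply/colP => i; rewrite !mxE !enum_rankK /=; by case: (v l i 0).
  exists x.
    move=> m; rewrite /box mxE; have hv1 k i j := le_trans (hv k i j) e1.
    case: (enum_val m) => l [[[] i]|] /=; rewrite in_itv /= -?ler_norml //.
      by case: (nodes_bounded l i hv1).
    by case: (nodes_bounded l i hv1).
  rewrite -sumr_const; apply: ler_sum => q _.
  under eq_bigr do rewrite xt xv.
  exact: hv.
have A0 : A !=set0 by have [x Ax _] := in_A 1 ltr01 (lexx 1); exists x.
have [x /[!inE] Ax xmin] := EVT_min_rV A0 cA (continuous_subspaceT objective_continuous).
have obj0 q : norm1 (\sum_l atom (node_of x l) (vector_of x l) q.1 q.2.1 q.2.2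
    - V q.1 q.2.1 q.2.2) = 0.
  have : objective x <= 0.
    rewrite leNgt; apply/negP => ox.
    pose m := #|{: 'I_d.+1 * ('I_n * 'I_n)}|.
    (* Dividing by [m + 1] rather than [m] makes [e *+ m] strictly smaller than the supposed
       positive minimum; the cap 1 is the accuracy under which the vectors stay in the box. *)
    pose e := Num.min 1 (objective x / m.+1%:R).
    have e0 : 0 < e by rewrite lt_min ltr01 divr_gt0.
    have [y Ay oy] := in_A e e0 ltac:(by rewrite ge_min lexx).
    have : objective x <= e *+ m by apply: le_trans oy; apply: xmin; rewrite inE.
    apply/negP; rewrite -ltNge.
    have : e * m.+1%:R <= objective x by rewrite -ler_pdivlMr // ge_min lexx orbT.
    by apply: lt_le_trans; rewrite -[e *+ m]mulr_natr ltr_pM2l // ltr_nat.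
  move=> ox; have : objective x == 0.
    by rewrite eq_le ox sumr_ge0 // => ? _; exact: norm1_ge0.
  by rewrite psumr_eq0 => [/allP/(_ q (mem_index_enum q))/eqP|? _]; last exact: norm1_ge0.
exists (node_of x), (vector_of x); split.
  by move=> l; have := Ax (enum_rank (l, None)); rewrite /box enum_rankK /= in_itv.
move=> k i j; apply/esym/eqP; rewrite -subr_eq0 -norm1_eq0; apply/eqP.
exact: (obj0 (k, (i, j))).
Qed.

End Quadrature.

(** * The dilation *)

(** The spectral decomposition chosen for a diagonal matrix need not be the trivial one. Its unitary
    matrix [P] can have a nonzero entry [P i j] only where [D 0 i = w 0 j], so it intertwines the
    two diagonals after applying [f] as well. *)
Lemma normal_fc_diag (R : realType) m (f : R[i]^o -> R[i]^o) (w : 'rV[R[i]]_m) :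
  normal_fc f (diag_mx w) = diag_mx (map_mx f w).
Proof.
have nN : diag_mx w \is normalmx.
  apply/normalmxP; rewrite tr_diag_mx map_diag_mx /=; exact: diag_mxC.
have /orthomx_spectralP NE := nN.
set P := spectralmx (diag_mx w) in NE *; set D := spectral_diag (diag_mx w) in NE *.
have uP : P \in unitmx by exact: spectral_unit.
have PN : P *m diag_mx w = diag_mx D *m P by rewrite {1}NE -mulmxA mulKVmx.
rewrite /normal_fc -/P -/D -mulmxA; apply: (canLR (mulKmx uP)).
apply/matrixP => i j; move/matrixP/(_ i j): PN.
rewrite !(mul_mx_diag, mul_diag_mx) !mxE.
have [->|Pij] := eqVneq (P i j) 0; first by rewrite !mulr0 !mul0r.
rewrite mulrC => /(mulIf Pij) ->; exact: mulrC.
Qed.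

Lemma spectrum_diag (R : realType) m (w : 'rV[R[i]]_m) z :
  spectrum (diag_mx w) z -> exists l, z = w 0 l.
Proof.
move=> /eigenvalueP[v vN /rV0Pn[l vl]]; exists l.
move/rowP/(_ l): vN; rewrite mul_mx_diag !mxE => /esym.
by rewrite [v 0 l * _]mulrC => /(mulIf vl).
Qed.

Theorem corollary4p10 (R : realType)
    (Omega : set R[i]^o) (gamma : R -> R[i]^o)
    (Omega_bounded : bounded_set Omega)
    (Omega_open : open Omega)
    (Omega_convex : convex_set Omega)
    (Omega_boundary : smooth_boundary Omega gamma)
    (n : nat) (T : 'M[R[i]]_n)
    (WT : numerical_range T `<=` Omega)
    (A : set (R[i]^o -> R[i]^o)) (d : nat)
    (A_sub : A `<=` A_alg Omega)
    (A_dim : is_subspace_of_dim A d) :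
  exists (m : nat) (J : 'M[R[i]]_(m, n)) (N : 'M[R[i]]_m),
    [/\ isometry_mx J,
        N \is normalmx,
        spectrum N `<=` bdry Omega,
        forall f, A f ->
          hol_fc Omega f T + (hol_fc Omega (cauchy_conj gamma f) T)^t*
            = 2 *: compression J (normal_fc f N)
      & (m <= 2 * n ^ 3 * (d + 1))%N].
Proof.
(* For [n = 0] the zero space serves as K; the resolvent lemmas concern matrices of positive
   size. *)
case: n T WT => [|n] T WT.
  exists 0%N, 0, 0; split => //.
  - by apply/matrixP => -[].
  - by apply/normalmxP; apply/matrixP => -[].
  - by move=> z /eigenvalueP[v _ /rV0Pn[[]]].
  - by move=> f _; apply/matrixP => -[].
have [a [_ AE]] := A_dim.
have Aa k : A (a k).
  rewrite AE; exists (fun j => (j == k)%:R) => z.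
  by rewrite (bigD1 k) //= eqxx mul1r big1 ?addr0 // => j /negbTE ->; rewrite mul0r.
pose psi (k : 'I_d.+1) t : R[i] := if unlift ord0 k is Some j then a j (gamma t) else 1.
have cpsi k : ccont (psi k).
  rewrite /psi; case: unlift => [j|]; last exact: ccont_cst.
  by apply: (A_alg_ccont Omega_boundary); apply: A_sub.
have psi0 t : psi ord0 t = 1 by rewrite /psi unlift_none.
pose M := double_layer gamma T.
have cM i j : ccont (fun t => M t i j).
  exact: (double_layer_ccont Omega_open Omega_boundary WT).
have [t [v [_ tv]]] := @quadrature R n.+1 d M psi cM
  (double_layer_hermitian gamma T)
  (double_layer_ge0 Omega_open Omega_convex Omega_boundary WT) cpsi psi0.
set m := #|_| in t v tv.
(* The kernel has mass 2, so the vectors are divided by [sqrt 2] to form the rows of an isometry;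
   the factor 2 in front of the compression restores the other integrals. *)
pose c : R[i] := (Num.sqrt 2)^-1%:C.
have cJ : Num.conj c = c by apply: complex_ext; rewrite !partsE ?oppr0.
have cc : 2 * (c * c) = 1.
  rewrite /c -rmorphM -invfM -expr2 sqr_sqrtr // -(rmorph_nat (real_complex R)) -rmorphM.
  by rewrite mulfV // rmorph1.
pose J : 'M[R[i]]_(m, n.+1) := \matrix_(l, i) (c * Num.conj (v l i 0)).
pose w : 'rV[R[i]]_m := \row_l gamma (t l).
have compE (u : 'rV[R[i]]_m) i j : (2 *: compression J (diag_mx u)) i j =
    \sum_l u 0 l * (v l i 0 * Num.conj (v l j 0)).
  rewrite mxE /compression mxE mulr_sumr; apply: eq_bigr => l _.
  rewrite mul_mx_diag mxE adjmxE !mxE rmorphM /= conjCK cJ.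
  transitivity (2 * (c * c) * (u 0 l * (v l i 0 * Num.conj (v l j 0)))); first by ring.
  by rewrite cc mul1r.
have quad1 i j : \sum_l v l i 0 * Num.conj (v l j 0) = 2 * (i == j)%:R.
  rewrite -(double_layer_integral Omega_open Omega_boundary WT).
  have := tv ord0 i j; rewrite /M => e.
  rewrite (_ : \sum_l _ = \sum_l psi ord0 (t l) * (v l i 0 * Num.conj (v l j 0))).
    by rewrite -e; apply: eq_cintegral => s _; rewrite psi0 mul1r.
  by apply: eq_bigr => l _; rewrite psi0 mul1r.
exists m, J, (diag_mx w); split.
- apply/matrixP => i j; have := compE (const_mx 1) i j.
  rewrite diag_const_mx /compression mulmx1 mxE => e.
  have two0 : (2 : R[i]) != 0 by rewrite pnatr_eq0.
  apply: (mulfI two0); rewrite e.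
  under eq_bigr do rewrite mxE mul1r.
  by rewrite quad1 mxE.
- apply/normalmxP; rewrite tr_diag_mx map_diag_mx /=; exact: diag_mxC.
- move=> z /spectrum_diag[l ->]; rewrite mxE; exact: (boundary_bdry Omega_boundary).
- move=> f Af; apply/matrixP => i j.
  rewrite (double_layer_calculus Omega_open Omega_convex Omega_boundary WT i j (A_sub f Af)).
  rewrite normal_fc_diag compE.
  move: Af; rewrite AE => -[b fE].
  under eq_cintegral do rewrite fE mulr_suml.
  rewrite cintegral_sum; last first.
    move=> k _; apply: ccontM => //; apply: ccontM; first exact: ccont_cst.
    by apply: (A_alg_ccont Omega_boundary); apply: A_sub.
  under [RHS]eq_bigr do rewrite !mxE fE mulr_suml.
  rewrite exchange_big /=; apply: eq_bigr => k _.
  have e := tv (lift ord0 k) i j; rewrite /psi liftK in e.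
  under eq_cintegral do rewrite -mulrA.
  under [RHS]eq_bigr do rewrite -mulrA.
  rewrite -mulr_sumr -e cintegralMl //; apply: ccontM => //.
  by apply: (A_alg_ccont Omega_boundary); apply: A_sub.
(* [m] equals [2 n^2 (d + 1)] for the positive size [n] at hand, and [n^2 <= n^3]. *)
- rewrite /m !card_prod card_bool !card_ord addn1 mulnCA mulnC leq_pmul2r //.
  by rewrite leq_pmul2l // !expnS expn0 muln1 leq_pmull.
Qed.
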